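(* There is an absolute constant $c$ such that for every positive integer $k$ and every prime $n \equiv 1 \pmod 4$ with $n \geq 2^{ck\log^2 k}$, every graph on $k$ vertices occurs as an induced monochromatic copy in all $2$-edge-colorings of the Paley graph $P_n$.
   Context: All graphs are finite and simple; $\log$ is to base $2$, and $\log^2 k=(\log k)^2$. For a prime power $n \equiv 1 \pmod 4$ (so that $-1$ is a square in the finite field $\mathbb{F}_n$), the Paley graph $P_n$ has vertex set $\mathbb{F}_n$, and distinct elements $x,y \in \mathbb{F}_n$ are adjacent if and only if $x-y$ is a square in $\mathbb{F}_n$. An induced monochromatic copy of $H$ in an edge-colored graph $G$ is an induced subgraph of $G$ isomorphic to $H$ all of whose edges have the same color. *)

(* Defs.v *)
From HB Require Import structures.
From mathcomp Require Import all_boot all_order all_algebra all_fingroup.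
From mathcomp Require Import all_solvable all_field.
From mathcomp Require Import reals exp.

Set Implicit Arguments.
Unset Strict Implicit.
Unset Printing Implicit Defensive.

Import GRing.Theory.

Local Open Scope ring_scope.

Definition log2 (R : realType) (x : R) : R := ln x / ln 2.

Record sgraph (V : finType) := SGraph {
  adj :> rel V;
  adj_sym : symmetric adj;
  adj_irr : irreflexive adj }.

Definition isomorphic (V W : finType) (G : sgraph V) (H : sgraph W) : Prop :=
  exists2 f : V -> W, bijective f & {mono f : x y / G x y >-> H x y}.

Section InducedColoring.

Variables (V : finType) (G : sgraph V).

Definition induced_adj (S : {set V}) : rel {x : V | x \in S} :=
  fun x y => G (val x) (val y).

Lemma induced_sym (S : {set V}) : symmetric (@induced_adj S).
Proof. by move=> x y; apply: adj_sym. Qed.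

Lemma induced_irr (S : {set V}) : irreflexive (@induced_adj S).
Proof. by move=> x; apply: adj_irr. Qed.

Definition induced (S : {set V}) : sgraph {x : V | x \in S} :=
  SGraph (@induced_sym S) (@induced_irr S).

Definition edges : {set {set V}} :=
  [set e : {set V} | [exists x, exists y, G x y && (e == [set x; y])]].

Definition edge_coloring (q : nat) := {e : {set V} | e \in edges} -> 'I_q.

(* The edges of [induced S] are exactly the edges of [G] contained in [S]. *)
Definition monochromatic_on (q : nat) (chi : edge_coloring q) (S : {set V}) :
    Prop :=
  exists a : 'I_q,
    forall e : {e : {set V} | e \in edges}, val e \subset S -> chi e = a.

Definition has_induced_mono_copy (W : finType) (H : sgraph W)
    (q : nat) (chi : edge_coloring q) : Prop :=
  exists S : {set V}, isomorphic (induced S) H /\ monochromatic_on chi S.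

End InducedColoring.

Section Paley.

Variable F : finFieldType.

Definition is_square (x : F) : bool := [exists z, x == z ^+ 2].

Definition paley_adj : rel F := fun x y => (x != y) && is_square (x - y).

Lemma paley_irr : irreflexive paley_adj.
Proof. by move=> x; rewrite /paley_adj eqxx. Qed.

Hypothesis cardF : (#|F| = 1 %[mod 4])%N.

Lemma is_square_N1 : is_square (-1).
Proof.
have /cyclicP[u genu] := field_unit_group_cyclic [set: {unit F}]%G.
have ordu : #[u]%g = #|F|.-1 by rewrite orderE -genu card_finField_unit.
have cF : (1 < #|F|)%N := card_finNzRing_gt1 F.
have dv4 : (4 %| #|F|.-1)%N.
  by have /eqP := cardF; rewrite eqn_mod_dvd ?subn1 //; apply: ltnW.
have [m Em] := dvdnP dv4.
have m_gt0 : (0 < m)%N.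
  by move: cF; rewrite -subn_gt0 subn1 Em muln_gt0 => /andP[].
pose v : F := FinRing.uval u.
have vX i : FinRing.uval (u ^+ i)%g = v ^+ i by rewrite FinRing.val_unitX.
have v4 : (v ^+ (2 * m)) ^+ 2 = 1.
  rewrite -exprM (_ : (2 * m * 2 = #|F|.-1)%N) -?ordu -?vX ?expg_order //.
  by rewrite ordu Em mulnAC mulnC.
have v2 : v ^+ (2 * m) != 1.
  apply/negP; rewrite -vX => /eqP E.
  have /eqP : (u ^+ (2 * m) = 1)%g by apply: val_inj.
  rewrite -order_dvdn ordu Em => /dvdn_leq.
  by rewrite mulnC leq_pmul2l // muln_gt0 m_gt0 => /(_ isT).
apply/existsP; exists (v ^+ m); rewrite -exprM mulnC eq_sym.
by move/eqP: v4; rewrite sqrf_eq1 (negPf v2).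
Qed.

Lemma paley_sym : symmetric paley_adj.
Proof.
suff imp x y : is_square (x - y) -> is_square (y - x).
  by move=> x y; rewrite /paley_adj eq_sym; congr andb; apply/idP/idP; apply: imp.
case/existsP => z /eqP xyz; have /existsP[i /eqP Ei] := is_square_N1.
by apply/existsP; exists (i * z); rewrite exprMn -Ei -xyz mulN1r opprB.
Qed.

Definition paley : sgraph F := SGraph paley_sym paley_irr.

End Paley.

Lemma card_Fp_mod4 (n : nat) :
  prime n -> (n = 1 %[mod 4])%N -> (#|'F_n| = 1 %[mod 4])%N.
Proof. by move=> n_pr; rewrite card_Fp. Qed.

Definition paley_Fp (n : nat) (n_pr : prime n)
    (n_mod4 : (n = 1 %[mod 4])%N) :
    sgraph 'F_n :=
  paley (card_Fp_mod4 n_pr n_mod4).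

(* Main.v *)
Require Import Defs.
From mathcomp Require Import all_boot all_order all_algebra.
From mathcomp Require Import fingroup cyclic finfield.
From mathcomp Require Import reals exp.
From mathcomp Require Import ring lra zify.

(** Why the theorem is true (after Fox and Sudakov).  Only one property of the
    Paley graph on [n] vertices is used: its Seidel matrix has norm at most the
    square root of [n] ([paley_seidel_bounded]), so that between any two sets of
    size well above that root the edges look like those of a random graph of
    density 1/2.

    Call the colours red and blue, and fix the threshold [r = k ^- 9].  If some
    set [U] is such that the red density between any two large disjoint subsets
    of [U] is at least [r], then [H] is embedded in red vertex by vertex
    ([dense_embedding]).  A candidate set keeps at each step a proportion of at
    least [r], which dictates that large should mean a proportion of about
    [r ^ k] of [U].

    Otherwise every set that is not too small contains two large disjoint sets
    with red density at most [r].  Splitting repeatedly, [up_log 2 k] times, gives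
    at least [k] disjoint sets with pairwise red density at most [k ^- 8] up to a
    constant ([sparse_family]).  Their sizes are [n] divided by about
    [(r ^- k) ^ (log2 k)], and this is the source of the exponent
    [k * log2 k ^ 2].  Between these sets almost all edges are blue, and [H] is
    embedded in blue with one vertex in each set ([sparse_embedding]).  The
    candidate sets become too small for a bound on the red density to pass to
    them automatically.  But a typical choice of an image halves the candidate
    sets and leaves the red densities between them unchanged on average, by the
    norm bound again; so the total red density serves as a potential that hardly
    grows.  It starts at most at 1/8, stays below 1, and at the end, when all
    candidate sets are single vertices, that means that no red edge is used
    ([potential_embedding]). *)

Set Implicit Arguments.
Unset Strict Implicit.
Unset Printing Implicit Defensive.

Import Order.TTheory GRing.Theory Num.Theory.

Local Open Scope ring_scope.

(** * The Seidel matrix of the Paley graph *)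

(** The Seidel matrix.  For the Paley graph it is the matrix of the quadratic
    character of [x - y], and an indicator of adjacency or of non-adjacency is
    an affine function of its entry. *)
Definition seidel (R : numDomainType) (V : finType) (G : sgraph V) (x y : V) : R :=
  if x == y then 0 else if G x y then 1 else -1.

Section QuadraticCharacter.

Variables (R : realFieldType) (F : finFieldType).
Hypothesis cardF : (#|F| = 1 %[mod 4])%N.

Definition qchar (x : F) : R :=
  if x == 0 then 0 else if is_square x then 1 else -1.

(** In terms of a generator of the multiplicative group, squareness is parity of
    the discrete logarithm; this is well defined because the order of the group
    is even. *)
Lemma primitive_element : exists u : F, [/\ u != 0,
  forall x, x != 0 -> exists i, x = u ^+ i &
  forall i, is_square (u ^+ i) = ~~ odd i].
Proof.
have /cyclicP[u genu] := field_unit_group_cyclic [set: {unit F}]%G.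
have ordu : #[u]%g = #|F|.-1 by rewrite orderE -genu card_finField_unit.
pose v : F := FinRing.uval u.
have vX i : FinRing.uval (u ^+ i)%g = v ^+ i by rewrite FinRing.val_unitX.
have gen x : x != 0 -> exists i, x = v ^+ i.
  rewrite -unitfE => Ux; have : FinRing.Unit Ux \in <[u]>%g by rewrite -genu inE.
  by case/cycleP => i Ei; exists i; rewrite -vX -Ei.
have v0 : v != 0 by rewrite -unitfE; exact: (valP u).
exists v; split=> // i; apply/existsP/idP => [[z /eqP Ez]|].
  have z0 : z != 0 by apply: contra_neq (expf_neq0 i v0) => z0; rewrite Ez z0 expr0n.
  have [j Ej] := gen z z0.
  have : (u ^+ i == u ^+ (j * 2))%g.
    by apply/eqP/val_inj => /=; rewrite !vX Ez Ej exprM.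
  rewrite eq_expg_mod_order => /eqP ij.
  have ev : (2 %| #[u]%g)%N.
    rewrite ordu; have := finNzRing_gt1 F; move: cardF; clear; lia.
  have := congr1 (modn^~ 2) ij; rewrite !modn_dvdm // !modn2 oddM andbF.
  by case: (odd i).
move/even_halfK => <-; exists (v ^+ i./2); by rewrite -exprM muln2.
Qed.

Lemma qcharM x y : qchar (x * y) = qchar x * qchar y.
Proof.
have [u [u0 gen sq]] := primitive_element.
have [->|x0] := eqVneq x 0; first by rewrite mul0r /qchar eqxx mul0r.
have [->|y0] := eqVneq y 0; first by rewrite mulr0 /qchar eqxx mulr0.
rewrite /qchar mulf_eq0 (negPf x0) (negPf y0) /=.
have [i ->] := gen x x0; have [j ->] := gen y y0.
by rewrite -exprD !sq oddD; case: (odd i); case: (odd j); rewrite /= ?mulN1r ?mul1r ?opprK.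
Qed.

(** Multiplication by a non-square permutes the field and changes the sign of
    every term. *)
Lemma sum_qchar : \sum_x qchar x = 0.
Proof.
have [u [u0 gen sq]] := primitive_element.
have E : qchar u = -1 by rewrite /qchar (negPf u0) -[u]expr1 sq.
suff : \sum_x qchar x = - \sum_x qchar x by lra.
rewrite {1}(reindex_inj (mulfI u0)) /= -sumrN.
by apply: eq_bigr => x _; rewrite qcharM E mulN1r.
Qed.

Lemma qchar_sqr x : qchar x * qchar x = (x != 0)%:R.
Proof.
by rewrite /qchar; case: eqP; rewrite ?mul0r //; case: is_square; rewrite ?mul1r ?mulN1r ?opprK.
Qed.

(** For [x != 0] the summand is [qchar (x ^+ 2 * (1 + c / x))], that is
    [qchar (1 + c / x)], and [1 + c / x] takes every value except [1]. *)
Lemma sum_qchar_shift c : c != 0 -> \sum_x qchar x * qchar (x + c) = -1.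
Proof.
move=> c0.
have E x : x != 0 -> qchar x * qchar (x + c) = qchar (1 + c / x).
  move=> x0; have -> : x + c = x * (1 + c / x) by field.
  by rewrite qcharM mulrA qchar_sqr x0 mul1r.
have inj : {in predC1 0, injective (fun x : F => 1 + c / x)}.
  by move=> x _ y /addrI /(mulfI c0) /invr_inj.
rewrite (bigD1 0) //= {1}/qchar eqxx mul0r add0r.
rewrite (eq_bigr (fun x => qchar (1 + c / x))) => [|x x0]; last exact: E.
have := sum_qchar; rewrite (bigD1 1) //= {1}/qchar oner_eq0.
have -> : is_square (1 : F) by apply/existsP; exists 1; rewrite expr1n.
move=> S; suff -> : \sum_(x : F | x != 0) qchar (1 + c / x) = \sum_(x : F | x != 1) qchar x by lra.
rewrite [RHS](reindex (fun x : F => 1 + c / x)) /=.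
  apply: eq_bigl => x; have [->|x0] := eqVneq x 0; first by rewrite invr0 mulr0 addr0 eqxx.
  by rewrite -[X in _ == X]addr0 (inj_eq (addrI 1)) mulf_eq0 invr_eq0 (negPf c0) (negPf x0).
exists (fun y => c / (y - 1)) => x _.
  have [->|x0] := eqVneq x 0; first by rewrite invr0 mulr0 addr0 subrr invr0 mulr0.
  by rewrite (addrC 1) addrK invf_div mulrC divfK.
have [->|x1] := eqVneq x 1; first by rewrite subrr invr0 mulr0 invr0 mulr0 addr0.
have : x - 1 != 0 by rewrite subr_eq0.
by move=> h; field; rewrite h c0.
Qed.

Lemma seidel_paley x y : seidel R (paley cardF) x y = qchar (x - y).
Proof.
rewrite /seidel /qchar subr_eq0 /= /paley_adj.
by case: eqP.
Qed.
End QuadraticCharacter.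

Lemma CauchySchwarz_sum (R : realFieldType) (I : finType) (f g : I -> R) :
  (\sum_i f i * g i) ^+ 2 <= (\sum_i f i ^+ 2) * (\sum_i g i ^+ 2).
Proof.
set a := \sum_i f i ^+ 2; set b := \sum_i _ * _; set c := \sum_i g i ^+ 2.
have H (t s : R) : 0 <= t ^+ 2 * a + 2 * t * s * b + s ^+ 2 * c.
  have -> : t ^+ 2 * a + 2 * t * s * b + s ^+ 2 * c = \sum_i (t * f i + s * g i) ^+ 2.
    rewrite !mulr_sumr -!big_split /=; apply: eq_bigr => i _; ring.
  by apply: sumr_ge0 => i _; apply: sqr_ge0.
have c0 : 0 <= c by apply: sumr_ge0 => i _; apply: sqr_ge0.
have [c00|cn] := eqVneq c 0; last first.
  have := H c (- b); have : 0 < c by rewrite lt_def cn.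
  move=> cp; have -> : c ^+ 2 * a + 2 * c * - b * b + (- b) ^+ 2 * c = c * (a * c - b ^+ 2) by ring.
  by rewrite pmulr_rge0 // subr_ge0.
have := H b (- (a + 1) / 2); rewrite c00.
have := H 0 1; have := H 1 0 => *; have : 0 <= a by nra. move=> ?.
nra.
Qed.

(** The Seidel matrix, as an operator on the euclidean space of functions on the
    vertices, has norm at most the square root of the number of vertices.  This
    is the only pseudo-randomness of the graph that is used below. *)
Definition seidel_bounded (R : numDomainType) (V : finType) (G : sgraph V) :=
  forall f g : V -> R,
  (\sum_x \sum_y f x * g y * seidel R G x y) ^+ 2 <=
    #|V|%:R * (\sum_x f x ^+ 2) * (\sum_y g y ^+ 2).

(** By Cauchy-Schwarz it is enough to bound the norm of the image of [g].  The
    columns of the matrix have pairwise inner products [-1] and squared norm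
    [#|F| - 1], so that squared norm is [#|F|] times the squared norm of [g],
    minus a square. *)
Lemma paley_seidel_bounded (R : realFieldType) (F : finFieldType) (cardF : (#|F| = 1 %[mod 4])%N) :
  seidel_bounded R (paley cardF).
Proof.
move=> f g.
pose h x := \sum_y g y * qchar R (x - y).
have -> : \sum_x \sum_y f x * g y * seidel R (paley cardF) x y = \sum_x f x * h x.
  apply: eq_bigr => x _; rewrite mulr_sumr; apply: eq_bigr => y _.
  by rewrite seidel_paley mulrA.
apply: le_trans (CauchySchwarz_sum _ _) _.
rewrite -mulrA mulrCA; apply: ler_wpM2l; first by apply: sumr_ge0 => i _; apply: sqr_ge0.
have orth (y z : F) : \sum_x qchar R (x - y) * qchar R (x - z) = #|F|%:R * (y == z)%:R - 1.
  rewrite (reindex_inj (addIr y)) /=.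
  under eq_bigr do rewrite addrK -addrA.
  have [<-|yz] := eqVneq y z; last by rewrite mulr0 sub0r (sum_qchar_shift _ cardF) // subr_eq0.
  under eq_bigr do rewrite subrr addr0 qchar_sqr.
  rewrite mulr1 -natr_sum (_ : \sum_(i : F) _ = #|F|.-1)%N.
    by rewrite -subn1 natrB // ltnW // finNzRing_gt1.
  by rewrite -big_mkcond sum1_card (eq_card (B:= predC1 0)) // cardC1.
have -> : \sum_x h x ^+ 2 = #|F|%:R * (\sum_y g y ^+ 2) - (\sum_y g y) ^+ 2.
  transitivity (\sum_x \sum_y \sum_z g y * g z * (qchar R (x - y) * qchar R (x - z))).
    apply: eq_bigr => x _; rewrite expr2 /h mulr_suml; apply: eq_bigr => y _.
    rewrite mulr_sumr; apply: eq_bigr => z _; ring.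
  rewrite exchange_big /= expr2 mulr_sumr mulr_suml -sumrB; apply: eq_bigr => y _.
  rewrite exchange_big /= mulr_sumr.
  transitivity (\sum_z (g y * g z * #|F|%:R * (y == z)%:R - g y * g z)).
    apply: eq_bigr => z _; rewrite -mulr_sumr orth; ring.
  rewrite sumrB; congr (_ - _); rewrite (bigD1 y) //= eqxx mulr1 big1 ?addr0.
    by ring.
  by move=> z; rewrite eq_sym => /negPf ->; rewrite mulr0.
by rewrite gerBl sqr_ge0.
Qed.

(** * Counting in finite sets *)

Section Counting.
Variables (R : realFieldType) (V : finType).
Implicit Types (A B : {set V}) (w : rel V).

Lemma sum_indicator A (P : pred V) :
  \sum_(x in A) (P x)%:R = #|[set x in A | P x]|%:R :> R.
Proof.
rewrite -natr_sum -sum1_card; congr _%:R.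
rewrite [LHS](eq_bigr (fun x => if P x then 1 else 0)%N); last by move=> x _; case: (P x).
by rewrite -big_mkcondr; apply: eq_bigl => x; rewrite inE.
Qed.

Lemma sum_const A (c : R) : \sum_(x in A) c = #|A|%:R * c.
Proof. by rewrite sumr_const mulr_natl. Qed.

(** Union bound. *)
Lemma card_avoid (I : eqType) A (s : seq I) (bad : I -> pred V) (b : R) :
  {in s, forall i, #|[set x in A | bad i x]|%:R <= b} ->
  #|A|%:R - (size s)%:R * b <= #|[set x in A | ~~ has (bad^~ x) s]|%:R.
Proof.
elim: s => [|i s IH] H.
  by rewrite mul0r subr0 ler_nat subset_leq_card //; apply/subsetP => x; rewrite inE => ->.
have {}IH := IH (fun l ls => H l (mem_behead (s := i :: s) ls)).
have := H i (mem_head i s).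
set X := [set x in A | _] in IH *; set Y := [set x in A | bad i x].
set Z := [set x in A | _] => Hi.
have : (#|X| <= #|Y| + #|Z|)%N.
  apply: leq_trans (leq_card_setU _ _); apply: subset_leq_card; apply/subsetP => x.
  by rewrite !inE /= => /andP[-> /=] /negPf ->; rewrite orbF; case: (bad i x).
rewrite -(ler_nat R) natrD /= -natr1 => h.
lra.
Qed.

Lemma markov_card A (h : V -> R) (a : R) :
  {in A, forall x, 0 <= h x} ->
  #|[set x in A | a < h x]|%:R * a <= \sum_(x in A) h x.
Proof.
move=> h0; rewrite (bigID (fun x => a < h x)) /=.
rewrite -[X in X <= _]addr0; apply: lerD; last first.
  by apply: sumr_ge0 => x /andP[xA _]; exact: h0.
rewrite -sum_const [leLHS](eq_bigl (fun x => (x \in A) && (a < h x))) => [|x]; last by rewrite inE.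
by apply: ler_sum => x /andP[_ /ltW].
Qed.

Lemma exists_le_average A (h : V -> R) (a : R) :
  (0 < #|A|)%N -> \sum_(x in A) h x <= #|A|%:R * a ->
  exists2 x, x \in A & h x <= a.
Proof.
move=> A0 H; apply/exists_inP; apply: contraLR H => /exists_inPn H.
have [x0 x0A] := card_gt0P A0.
rewrite -ltNge -sum_const (bigD1 x0) //= [X in _ < X](bigD1 x0) //=.
apply: ltr_leD; first by rewrite ltNge H.
by apply: ler_sum => x /andP[xA _]; rewrite ltW // ltNge H.
Qed.

Definition edge_count w A B : R := \sum_(x in A) \sum_(y in B) (w x y)%:R.

Lemma edge_countC w A B : symmetric w -> edge_count w A B = edge_count w B A.
Proof.
move=> sw; rewrite /edge_count exchange_big /=.
by apply: eq_bigr => y _; apply: eq_bigr => x _; rewrite sw.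
Qed.

End Counting.

(** * Seidel sums and degrees *)

Section SeidelSums.
Variables (R : realFieldType) (V : finType) (G : sgraph V).
Hypothesis G_bd : seidel_bounded R G.
Implicit Types (A B : {set V}).
Local Notation S := (seidel R G).
Local Notation n := (#|V|%:R : R).

Lemma seidel_sum_sqr A B f g :
  {in A, forall x, `|f x| <= 1} -> {in B, forall y, `|g y| <= 1} ->
  (\sum_(x in A) \sum_(y in B) f x * g y * S x y) ^+ 2 <= n * #|A|%:R * #|B|%:R.
Proof.
move=> fA gB.
have sq (C : {set V}) h : {in C, forall x, `|h x| <= 1} ->
    \sum_x (if x \in C then h x else 0) ^+ 2 <= #|C|%:R :> R.
  move=> hC; rewrite -[#|C|%:R]mulr1 -sum_const [leRHS]big_mkcond /=.
  apply: ler_sum => x _; case: ifP => [/hC|]; last by rewrite expr0n.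
  by rewrite -real_normK ?num_real // expr_le1.
have := G_bd (fun x => if x \in A then f x else 0) (fun y => if y \in B then g y else 0).
set L := \sum_x _; set L' := \sum_(x in A) _.
have -> : L = L'.
  rewrite /L /L' [RHS]big_mkcond /=; apply: eq_bigr => x _.
  case: ifP => xA; last by rewrite big1 // => y _; rewrite !mul0r.
  rewrite [RHS]big_mkcond /=; apply: eq_bigr => y _.
  by case: ifP => //; rewrite mulr0 mul0r.
move=> /le_trans; apply; rewrite -!mulrA; apply: ler_wpM2l => //.
by apply: ler_pM; rewrite ?sq //; apply: sumr_ge0 => x _; apply: sqr_ge0.
Qed.

Lemma seidel_sum_le A B f g K :
  {in A, forall x, `|f x| <= 1} -> {in B, forall y, `|g y| <= 1} ->
  0 < K -> n * K ^+ 2 <= #|A|%:R * #|B|%:R ->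
  `|\sum_(x in A) \sum_(y in B) f x * g y * S x y| <= #|A|%:R * #|B|%:R / K.
Proof.
move=> fA gB K0 nK.
have AB0 : 0 <= #|A|%:R * #|B|%:R :> R by rewrite mulr_ge0.
have K0' := ltW K0; rewrite -ler_sqr ?nnegrE ?normr_ge0 ?divr_ge0 //.
rewrite real_normK ?num_real //.
apply: le_trans (seidel_sum_sqr fA gB) _.
rewrite expr_div_n ler_pdivlMr ?exprn_gt0 // -!mulrA mulrC -!mulrA.
move: AB0 nK; set a := _ * _ => a0 nK.
rewrite (_ : #|A|%:R * _ = a * (n * K ^+ 2)); last by rewrite /a; ring.
by rewrite expr2 ler_wpM2l.
Qed.

Definition seidel_sign (p : bool) : R := if p then 1 else -1.

Lemma indicator_adj p x y : x != y ->
  (G x y == p)%:R = (1 + seidel_sign p * S x y) / 2 :> R.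
Proof.
by move=> /negPf xy; rewrite /seidel xy /seidel_sign; case: (G x y); case: p; rewrite /=; lra.
Qed.

Lemma norm_seidel_sign p : `|seidel_sign p| = 1.
Proof. by rewrite /seidel_sign; case: p; rewrite ?normrN normr1. Qed.

Lemma norm_seidel x y : `|S x y| <= 1.
Proof. by rewrite /seidel; do 2?case: ifP; rewrite ?normr0 ?normrN ?normr1. Qed.

Lemma disjoint_neq A B x y : [disjoint A & B] -> x \in A -> y \in B -> x != y.
Proof.
by move=> /pred0P dAB xA yB; apply/eqP => E; have := dAB x; rewrite /= xA E yB.
Qed.

(** Each vertex of low degree has a Seidel sum over [B] that is, up to the sign of
    [p], at most [- e * #|B|].  The norm bound allows such sums to add up only
    over few vertices. *)
Lemma card_low_degree p A B (e : R) : [disjoint A & B] -> 0 < e ->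
  #|[set x in A | #|[set y in B | G x y == p]|%:R < (1 - e) / 2 * #|B|%:R]|%:R
    * #|B|%:R * e ^+ 2 <= n.
Proof.
move=> dAB e0; set X := [set x in A | _].
have [B0|B0] := posnP #|B|; first by rewrite B0 mulr0 mul0r.
have [X0|X0] := posnP #|X|; first by rewrite X0 !mul0r.
have := @seidel_sum_sqr X B (fun=> - seidel_sign p) (fun=> 1).
set s := \sum_(x in X) _ => Hs.
have {}Hs : s ^+ 2 <= n * #|X|%:R * #|B|%:R.
  by apply: Hs => x _; rewrite ?normrN ?norm_seidel_sign ?normr1.
have sX : #|X|%:R * (e * #|B|%:R) <= s.
  rewrite -sum_const; apply: ler_sum => x; rewrite inE => /andP[xA].
  rewrite -sum_indicator (eq_bigr (fun y => (1 + seidel_sign p * S x y) / 2)); last first.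
    by move=> y yB; rewrite indicator_adj // (disjoint_neq dAB).
  rewrite -mulr_suml big_split /= sum_const mulr1.
  under [\sum_(y in B) (_ * 1 * _)]eq_bigr do rewrite mulr1 mulNr.
  rewrite sumrN; lra.
have Bp : 0 < #|B|%:R :> R by rewrite ltr0n.
have Xp : 0 < #|X|%:R :> R by rewrite ltr0n.
have : (#|X|%:R * (e * #|B|%:R)) ^+ 2 <= s ^+ 2.
  have ge0 : 0 <= #|X|%:R * (e * #|B|%:R) by apply/ltW; rewrite !mulr_gt0.
  by rewrite ler_sqr // nnegrE // (le_trans ge0).
move=> /le_trans /(_ Hs).
rewrite -[X in _ <= X]mulrA (_ : _ ^+ 2 = (#|X|%:R * #|B|%:R * e ^+ 2) * (#|X|%:R * #|B|%:R)).
  by rewrite ler_pM2r // mulr_gt0.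
ring.
Qed.

End SeidelSums.

(** * Greedy embedding *)

Section Greedy.
Variables (R : realFieldType) (V T : finType) (Q : T -> T -> rel V) (W : T -> {set V}).
Variables (m r : R).
Hypothesis Qsym : forall i j x y, Q i j x y = Q j i y x.
Hypotheses (m_gt0 : 0 < m) (r_gt0 : 0 < r) (r_le1 : r <= 1).
(* [Q i j x y] says that [x] and [y] are admissible images of [i] and [j]. *)
Hypothesis Q_dense : forall i j (A B : {set V}), i != j ->
  A \subset W i -> B \subset W j -> m <= #|A|%:R -> m <= #|B|%:R ->
  exists2 x, x \in A & r * #|B|%:R <= #|[set y in B | Q i j x y]|%:R.

(** Choose images one vertex at a time, and keep for each remaining vertex the set
    of candidates compatible with the choices so far.  A set of [m] candidates
    for [j] contains one that keeps a proportion [r] of the candidates for any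
    given [i]; hence fewer than [m] candidates for [j] are bad for [i], and the
    bound [k * m] on the number of candidates, relaxed by a factor [r] for each
    choice made, leaves a candidate that is bad for none. *)
Lemma greedy_embedding (v0 : V) (k : nat) (s : seq T) (U : T -> {set V}) :
  uniq s -> (size s <= k)%N -> {in s, forall i, U i \subset W i} ->
  {in s, forall i, k%:R * m <= r ^+ size s * #|U i|%:R} ->
  exists f : T -> V, {in s, forall i, f i \in U i} /\
    {in s &, forall i j, i != j -> Q i j (f i) (f j)}.
Proof.
elim: s U => [|j s IH] U /=; first by exists (fun=> v0); split.
move=> /andP[js us] sk UW Ubig.
pose bad i x := #|[set y in U i | Q j i x y]|%:R < r * #|U i|%:R.
have inS i : i \in s -> i \in j :: s by rewrite inE orbC => ->.
have big i : i \in j :: s -> k%:R * m <= #|U i|%:R.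
  move=> /Ubig /le_trans; apply; rewrite ler_piMl //.
  by rewrite exprn_ile1 // ltW.
have k1 : 1 <= k%:R :> R by rewrite ler1n (leq_trans _ sk).
have bigm i : i \in j :: s -> m <= #|U i|%:R.
  by move=> /big /(le_trans _); apply; rewrite ler_peMl // ltW.
have few : {in s, forall i, #|[set x in U j | bad i x]|%:R <= m}.
  move=> i si; rewrite leNgt; apply/negP => /ltW mX.
  have ij : j != i by apply: contraNneq js => ->.
  have [|x] := Q_dense ij _ (UW i (inS i si)) mX (bigm i (inS i si)).
    apply: subset_trans (UW j (mem_head _ _)).
    by apply/subsetP => x; rewrite inE => /andP[].
  by rewrite inE => /andP[_]; rewrite /bad ltNge => /negP.
have [x] : exists x, x \in [set x in U j | ~~ has (bad^~ x) s].
  apply/set0Pn; rewrite -card_gt0 -(ltr0n R).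
  apply: lt_le_trans (card_avoid few); rewrite subr_gt0.
  apply: lt_le_trans (big j (mem_head _ _)); rewrite ltr_pM2r // ltr_nat.
  exact: sk.
rewrite inE => /andP[xj /hasPn good].
pose U' i := [set y in U i | Q j i x y].
have U'W : {in s, forall i, U' i \subset W i}.
  move=> i si; apply: subset_trans (UW i (inS i si)).
  by apply/subsetP => y; rewrite inE => /andP[].
have U'big : {in s, forall i, k%:R * m <= r ^+ size s * #|U' i|%:R}.
  move=> i si; apply: le_trans (Ubig i (inS i si)) _.
  rewrite exprSr -mulrA ler_wpM2l ?exprn_ge0 ?(ltW r_gt0) //.
  by have := good i si; rewrite -leNgt.
have [f [fU' fQ]] := IH U' us (ltnW sk) U'W U'big.
exists (fun i => if i == j then x else f i); split=> [i|i l].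
  rewrite inE; case: eqP => [-> //|_ /= si].
  by have := fU' i si; rewrite inE => /andP[].
rewrite !inE; case: (i =P j) => [-> _|_ /= si]; case: (l =P j) => [-> _|_ /= sl] il.
- by rewrite eqxx in il.
- by have := fU' l sl; rewrite inE => /andP[].
- by rewrite Qsym; have := fU' i si; rewrite inE => /andP[].
- exact: fQ.
Qed.
End Greedy.

(** * Families of sets with pairwise small density *)

Section Doubling.
Variables (R : realFieldType) (V : finType) (w : rel V).
Variables (d r u0 : R) (N : nat).
Hypothesis w_sym : symmetric w.
Hypotheses (d_gt0 : 0 < d) (d_le1 : d <= 1) (r_gt0 : 0 < r) (u0_gt0 : 0 < u0).
Hypothesis sparse_pair : forall U : {set V}, u0 <= #|U|%:R ->
  exists A B : {set V}, [/\ A \subset U, B \subset U, [disjoint A & B],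
    d * #|U|%:R <= #|A|%:R /\ d * #|U|%:R <= #|B|%:R &
    edge_count R w A B <= r * #|A|%:R * #|B|%:R].

Definition sparse (A B : {set V}) : bool :=
  [disjoint A & B] && (edge_count R w A B <= 4 * N%:R * r * #|A|%:R * #|B|%:R).

(** Split a sparse pair [A], [B] and recurse, first inside [A] and then inside [B].
    Sparseness of a pair is not inherited by subsets, so both recursions are
    prepared.  The one in [A] takes place among the vertices whose degree to
    [B] is at most twice the bound [r * #|B|] on the average; then [B] is still
    sparse to each set [W] found there.  The one in [B] takes place among the
    vertices whose degree to every such [W] is at most [2 * N] times the bound on
    its average: each [W] excludes at most a proportion [1 / (2 * N)] of [B], and
    there are at most [N] of them.
    The bound between a set in [A] and a set in [B] is on individual degrees, so
    it does not deteriorate when later recursions pass to subsets of [B]. *)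
Lemma sparse_family (t : nat) (U : {set V}) : (2 ^ t <= N)%N ->
  u0 <= (d / 2) ^+ t * #|U|%:R ->
  exists Ws : seq {set V}, [/\ size Ws = (2 ^ t)%N,
    {in Ws, forall W : {set V}, W \subset U /\ (d / 2) ^+ t * #|U|%:R <= #|W|%:R} &
    pairwise sparse Ws].
Proof.
have d2 : 0 < d / 2 by rewrite divr_gt0.
have d21 : d / 2 <= 1 by rewrite ler_pdivrMr // mul1r (le_trans d_le1) // ler1n.
elim: t U => [|t IH] U tN uU.
  exists [:: U]; rewrite expn0; split=> // W; rewrite inE => /eqP ->.
  by rewrite mul1r.
have tN' : (2 ^ t <= N)%N by rewrite (leq_trans _ tN) // leq_pexp2l.
have [|A [B [AU BU dAB [Abig Bbig] eAB]]] := sparse_pair (U := U).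
  by apply: le_trans uU _; rewrite ler_piMl // exprn_ile1 // ltW.
have d2t : 0 < (d / 2) ^+ t by rewrite exprn_gt0.
have U0 : 0 < #|U|%:R :> R.
  by rewrite -(pmulr_rgt0 _ (exprn_gt0 t.+1 d2)) (lt_le_trans u0_gt0).
have dU0 := mulr_gt0 d_gt0 U0.
have A_gt0 := lt_le_trans dU0 Abig.
have B_gt0 := lt_le_trans dU0 Bbig.
have N_gt0 : 0 < N%:R :> R by rewrite ltr0n (leq_trans _ tN') // expn_gt0.
pose deg (X : {set V}) x : R := \sum_(y in X) (w x y)%:R.
have deg_ge0 X x : 0 <= deg X x by apply: sumr_ge0.
have half (X X0 : {set V}) : d * #|U|%:R <= #|X|%:R -> #|X|%:R - #|X|%:R / 2 <= #|X0|%:R :> R ->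
    (d / 2) ^+ t.+1 * #|U|%:R <= (d / 2) ^+ t * #|X0|%:R.
  by move=> h1 h2; rewrite exprSr -mulrA ler_wpM2l ?(ltW d2t) //; lra.
pose A0 := [set x in A | ~~ has (fun _ : unit => 2 * r * #|B|%:R < deg B x) [:: tt]].
have A0big : #|A|%:R - #|A|%:R / 2 <= #|A0|%:R :> R.
  rewrite -[_ / 2]mul1r.
  apply: (card_avoid (s := [:: tt]) (bad := fun _ x => 2 * r * #|B|%:R < deg B x)) => i _.
  have := markov_card (2 * r * #|B|%:R) (fun x (_ : x \in A) => deg_ge0 B x).
  move=> /le_trans /(_ eAB); set c := #|_|%:R => Hc.
  have : c * (2 * r * #|B|%:R) <= #|A|%:R / 2 * (2 * r * #|B|%:R).
    by apply: le_trans Hc _; rewrite le_eqVlt; apply/orP; left; apply/eqP; field.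
  by rewrite ler_pM2r // !mulr_gt0.
have A0A : A0 \subset A by apply/subsetP => x; rewrite inE => /andP[].
have [|Ws1 [sz1 Ws1P pw1]] := IH A0 tN'; first exact: le_trans uU (half _ _ Abig A0big).
pose badW (W : {set V}) x := 4 * N%:R * r * #|W|%:R < deg W x.
pose B0 := [set x in B | ~~ has (badW^~ x) Ws1].
have W_gt0 W : W \in Ws1 -> 0 < #|W|%:R :> R.
  move=> /Ws1P[_]; apply: lt_le_trans.
  by apply: lt_le_trans (half _ _ Abig A0big); rewrite mulr_gt0 // exprn_gt0.
have B0big : #|B|%:R - #|B|%:R / 2 <= #|B0|%:R :> R.
  have few : {in Ws1, forall W, #|[set x in B | badW W x]|%:R <= #|B|%:R / (2 * N%:R) :> R}.
    move=> W W1; have W0 := W_gt0 W W1.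
    have := markov_card (4 * N%:R * r * #|W|%:R) (fun x (_ : x \in B) => deg_ge0 W x).
    have : \sum_(x in B) deg W x <= #|W|%:R * (2 * r * #|B|%:R).
      rewrite -/(edge_count R w B W) edge_countC // -sum_const; apply: ler_sum => x xW.
      have [/subsetP WA0 _] := Ws1P W W1; have := WA0 x xW.
      by rewrite inE /= orbF -leNgt => /andP[].
    move=> h1 h2; have := le_trans h2 h1; rewrite -/(badW W); set c := #|_|%:R => Hc.
    have : c * (4 * N%:R * r * #|W|%:R) <= #|B|%:R / (2 * N%:R) * (4 * N%:R * r * #|W|%:R).
      apply: le_trans Hc _; rewrite le_eqVlt; apply/orP; left; apply/eqP.
      by field; rewrite gt_eqF.
    by rewrite ler_pM2r // !mulr_gt0.
  apply: le_trans (card_avoid few); rewrite lerD2l lerN2 sz1.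
  have : (2 ^ t)%:R <= N%:R :> R by rewrite ler_nat.
  move=> h; rewrite mulrA ler_pdivrMr ?mulr_gt0 //.
  have -> : #|B|%:R / 2 * (2 * N%:R) = N%:R * #|B|%:R :> R by field.
  by rewrite ler_pM2r.
have B0B : B0 \subset B by apply/subsetP => x; rewrite inE => /andP[].
have [|Ws2 [sz2 Ws2P pw2]] := IH B0 tN'; first exact: le_trans uU (half _ _ Bbig B0big).
exists (Ws1 ++ Ws2); split.
- by rewrite size_cat sz1 sz2 addnn expnS mul2n.
- move=> W; rewrite mem_cat => /orP[/Ws1P[WA0 Wbig]|/Ws2P[WB0 Wbig]].
    split; first exact: subset_trans (subset_trans WA0 A0A) AU.
    by apply: le_trans Wbig; apply: half A0big.
  split; first exact: subset_trans (subset_trans WB0 B0B) BU.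
  by apply: le_trans Wbig; apply: half B0big.
rewrite pairwise_cat pw1 pw2 !andbT; apply/allrelP => W W' W1 W2.
have [WA0 _] := Ws1P W W1; have [WB0 _] := Ws2P W' W2.
apply/andP; split.
  apply: disjointWl (subset_trans WA0 A0A) _.
  exact: disjointWr (subset_trans WB0 B0B) dAB.
rewrite edge_countC // [leRHS](_ : _ = #|W'|%:R * (4 * N%:R * r * #|W|%:R)); last by ring.
rewrite -sum_const; apply: ler_sum => x /(subsetP WB0).
by rewrite inE => /andP[_ /hasPn /(_ W W1)]; rewrite -leNgt.
Qed.
End Doubling.

(** * Embedding by a potential function *)

Section NeighbourhoodCounts.
Variables (R : realFieldType) (V : finType) (G : sgraph V).
Hypothesis G_bd : seidel_bounded R G.
Implicit Types (A B D : {set V}).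
Local Notation n := (#|V|%:R : R).
Local Notation S := (seidel R G).

(** Expand the adjacency indicator as [(1 + s * S) / 2]: the main term is half of
    the full sum, and the remainder is a Seidel sum. *)
Lemma sum_neighbours_le A B (c : pred V) p K :
  [disjoint A & B] -> 0 < K -> n * K ^+ 2 <= #|A|%:R * #|B|%:R ->
  \sum_(x in A) \sum_(y in B) (c y)%:R * (G x y == p)%:R <=
    #|A|%:R / 2 * (\sum_(y in B) (c y)%:R + #|B|%:R / K).
Proof.
move=> dAB K0 nK.
pose g y : R := (c y)%:R * seidel_sign R p.
rewrite (_ : \sum_(x in A) _ = (#|A|%:R * \sum_(y in B) (c y)%:R +
    \sum_(x in A) \sum_(y in B) 1 * g y * S x y) / 2); last first.
  rewrite -sum_const -big_split mulr_suml /=; apply: eq_bigr => x xA.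
  rewrite -big_split mulr_suml /=; apply: eq_bigr => y yB.
  by rewrite indicator_adj ?(disjoint_neq dAB) // /g; ring.
have := seidel_sum_le (f := fun=> 1) (g := g) G_bd _ _ K0 nK.
set s := \sum_(x in A) \sum_(y in B) _ => /(_ _ _)/ler_normlW Hs.
have {}Hs : s <= #|A|%:R * #|B|%:R / K.
  apply: Hs => x _; rewrite ?normr1 // normrM norm_seidel_sign mulr1.
  by case: (c x); rewrite ?normr1 ?normr0.
rewrite (_ : #|A|%:R / 2 * _ =
  (#|A|%:R * \sum_(y in B) (c y)%:R + #|A|%:R * #|B|%:R / K) / 2); last by ring.
by rewrite ler_pM2r ?lerD2l ?invr_gt0.
Qed.

(** The number of marked pairs whose two ends have prescribed adjacency to [x] is on
    average a quarter of all marked pairs.  Expanding both indicators leaves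
    three error terms; each becomes a Seidel sum between [A] and [B], or between
    [A] and [D], once the third variable is fixed.  For the product term, the
    factor [S x y] is a bounded weight on [x] when [y] is fixed. *)
Lemma sum_common_neighbours_le A B D (w : rel V) p q K :
  [disjoint A & B] -> [disjoint A & D] -> 0 < K ->
  n * K ^+ 2 <= #|A|%:R * #|B|%:R -> n * K ^+ 2 <= #|A|%:R * #|D|%:R ->
  \sum_(x in A) \sum_(y in B) \sum_(z in D)
     (w y z)%:R * (G x y == p)%:R * (G x z == q)%:R <=
    #|A|%:R / 4 * (edge_count R w B D + 3 * (#|B|%:R * #|D|%:R / K)).
Proof.
move=> dAB dAD K0 nB nD.
pose W y z : R := (w y z)%:R.
have W1 y z : `|W y z| <= 1 by rewrite /W; case: (w y z); rewrite ?normr1 ?normr0.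
pose sp := seidel_sign R p; pose sq := seidel_sign R q.
have bd (E : {set V}) (f g : V -> R) : n * K ^+ 2 <= #|A|%:R * #|E|%:R ->
    {in A, forall x, `|f x| <= 1} -> {in E, forall y, `|g y| <= 1} ->
    \sum_(x in A) \sum_(y in E) f x * g y * S x y <= #|A|%:R * #|E|%:R / K.
  by move=> nE fA gE; apply: ler_normlW; apply: (seidel_sum_le G_bd).
pose t2 := \sum_(z in D) \sum_(x in A) \sum_(y in B) 1 * (W y z * sp) * S x y.
pose t3 := \sum_(y in B) \sum_(x in A) \sum_(z in D) 1 * (W y z * sq) * S x z.
pose t4 := \sum_(y in B) \sum_(x in A) \sum_(z in D) (S x y) * (W y z * sp * sq) * S x z.
have n1 : `|1 : R| <= 1 by rewrite normr1.
have ns : forall y z, `|W y z * sp| <= 1 by move=> y z; rewrite normrM norm_seidel_sign mulr1.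
have ns' : forall y z, `|W y z * sq| <= 1 by move=> y z; rewrite normrM norm_seidel_sign mulr1.
have ns2 : forall y z, `|W y z * sp * sq| <= 1.
  by move=> y z; rewrite normrM norm_seidel_sign mulr1.
have h2 : t2 <= #|A|%:R * (#|B|%:R * #|D|%:R / K).
  rewrite [leRHS](_ : _ = #|D|%:R * (#|A|%:R * #|B|%:R / K)); last by ring.
  by rewrite -sum_const; apply: ler_sum => z _; apply: bd.
have h3 : t3 <= #|A|%:R * (#|B|%:R * #|D|%:R / K).
  rewrite [leRHS](_ : _ = #|B|%:R * (#|A|%:R * #|D|%:R / K)); last by ring.
  by rewrite -sum_const; apply: ler_sum => z _; apply: bd.
have h4 : t4 <= #|A|%:R * (#|B|%:R * #|D|%:R / K).
  rewrite [leRHS](_ : _ = #|B|%:R * (#|A|%:R * #|D|%:R / K)); last by ring.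
  rewrite -sum_const; apply: ler_sum => z _; apply: bd => // x _; exact: norm_seidel.
rewrite (_ : \sum_(x in A) _ = (#|A|%:R * edge_count R w B D + t2 + t3 + t4) / 4).
  rewrite [leRHS](_ : _ = (#|A|%:R * edge_count R w B D + #|A|%:R * (#|B|%:R * #|D|%:R / K)
    + #|A|%:R * (#|B|%:R * #|D|%:R / K) + #|A|%:R * (#|B|%:R * #|D|%:R / K)) / 4); last by field; rewrite gt_eqF.
  by rewrite ler_pM2r ?invr_gt0 // !lerD.
have e2 : t2 = \sum_(x in A) \sum_(y in B) \sum_(z in D) 1 * (W y z * sp) * S x y.
  by rewrite /t2 exchange_big; apply: eq_bigr => x _; rewrite exchange_big.
have e3 : t3 = \sum_(x in A) \sum_(y in B) \sum_(z in D) 1 * (W y z * sq) * S x z.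
  by rewrite /t3 exchange_big.
have e4 : t4 = \sum_(x in A) \sum_(y in B) \sum_(z in D) (S x y) * (W y z * sp * sq) * S x z.
  by rewrite /t4 exchange_big.
rewrite e2 e3 e4 -sum_const -!big_split mulr_suml /=; apply: eq_bigr => x xA.
rewrite /edge_count -!big_split mulr_suml /=; apply: eq_bigr => y yB.
rewrite -!big_split mulr_suml /=; apply: eq_bigr => z zD.
rewrite !indicator_adj ?(disjoint_neq dAB xA yB) ?(disjoint_neq dAD xA zD) // -/sp -/sq -/(W y z).
by field.
Qed.
End NeighbourhoodCounts.

Section Potential.
Variables (R : realFieldType) (V T : finType) (G : sgraph V) (H : rel T).
Variable w : T -> T -> rel V.
Hypothesis G_bd : seidel_bounded R G.
Hypothesis w_sym : forall i j x y, w i j x y = w j i y x.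
Implicit Types (U C : T -> {set V}) (s : seq T).
Local Notation n := (#|V|%:R : R).
Local Notation card U i := (#|pred_of_set (U i)|%:R : R).

Definition marked_density (A C : {set V}) : R :=
  (\sum_(y in A) (y \in C)%:R) / #|A|%:R.

Definition edge_density (v : rel V) (A B : {set V}) : R :=
  edge_count R v A B / (#|A|%:R * #|B|%:R).

(** [U i] are the candidates for the vertex [i], [C i] those among them that an
    earlier choice forbids, and [w i l] the pairs that may not be used for [i]
    and [l].  Every unordered pair of indices is counted twice in the double sum.
    The factor 2 is what keeps the potential from growing on average: when [j] is
    embedded, [U i] loses half of its elements, but all its elements that are
    [w j i]-related to the image may survive. *)
Definition potential s U C : R :=
  \sum_(i <- s) marked_density (U i) (C i) +
  \sum_(i <- s) \sum_(l <- s) edge_density (w i l) (U i) (U l).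

Definition shrink j x U i : {set V} := [set y in U i | G x y == H j i].
Definition mark j x C i : {set V} := C i :|: [set y | w j i x y].

(** The potential after [x] has been chosen for [j], with each new candidate set
    taken to have exactly half of its old size, plus a penalty if [x] is
    forbidden.  Having constant denominators, it can be averaged over [x] term
    by term. *)
Definition nominal j s U C x : R :=
  (x \in C j)%:R +
  \sum_(i <- s) 2 / card U i *
    (\sum_(y in U i) (y \in C i)%:R * (G x y == H j i)%:R + \sum_(y in U i) (w j i x y)%:R) +
  \sum_(i <- s) \sum_(l <- s) 4 / (card U i * card U l) *
    (\sum_(y in U i) \sum_(z in U l) (w i l y z)%:R * (G x y == H j i)%:R * (G x z == H j l)%:R).

Lemma edge_density_ge0 v A B : 0 <= edge_density v A B.
Proof. by rewrite divr_ge0 ?mulr_ge0 //; apply: sumr_ge0 => x _; apply: sumr_ge0. Qed.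

Lemma marked_density_ge0 (A C : {set V}) : 0 <= marked_density A C.
Proof. by rewrite divr_ge0 //; apply: sumr_ge0. Qed.

Lemma edge_densityC i l A B : edge_density (w i l) A B = edge_density (w l i) B A.
Proof.
rewrite /edge_density [X in _ / X]mulrC; congr (_ / _).
rewrite /edge_count exchange_big /=.
by apply: eq_bigr => y _; apply: eq_bigr => x _; rewrite w_sym.
Qed.

Lemma sum_seq_const s (c : R) : \sum_(i <- s) c = (size s)%:R * c.
Proof. by rewrite big_const_seq count_predT iter_addr_0 mulr_natl. Qed.

Lemma ler_sum_in s (f g : T -> R) : {in s, forall i, f i <= g i} ->
  \sum_(i <- s) f i <= \sum_(i <- s) g i.
Proof. by move=> fg; rewrite big_seq [leRHS]big_seq; apply: ler_sum. Qed.

Lemma nominal_average j s U C (K e : R) :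
  {in s, forall i, [disjoint U j & U i]} -> 0 < K ->
  {in j :: s, forall i, 0 < card U i} ->
  {in s, forall i, n * K ^+ 2 <= card U j * card U i} ->
  (size s)%:R / K + 3 * (size s)%:R ^+ 2 / K <= e ->
  \sum_(x in U j) nominal j s U C x <= card U j * (potential (j :: s) U C + e).
Proof.
move=> dU K0 U0 nK he.
have Uj0 := U0 j (mem_head _ _).
have inS i : i \in s -> i \in j :: s by rewrite inE orbC => ->.
rewrite !big_split /=.
have -> : \sum_(x in U j) (x \in C j)%:R = card U j * marked_density (U j) (C j).
  by rewrite mulrC divfK // gt_eqF.
have h1 : \sum_(x in U j) \sum_(i <- s) 2 / card U i *
    (\sum_(y in U i) (y \in C i)%:R * (G x y == H j i)%:R + \sum_(y in U i) (w j i x y)%:R)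
   <= card U j * (\sum_(i <- s) marked_density (U i) (C i) +
        2 * (\sum_(i <- s) edge_density (w j i) (U j) (U i)) + (size s)%:R / K).
  rewrite exchange_big /= -[_ / K]sum_seq_const mulr_sumr -!big_split mulr_sumr /=.
  apply: ler_sum_in => i si; rewrite -mulr_sumr big_split /=.
  have Ui0 := U0 i (inS i si).
  have h := sum_neighbours_le G_bd (mem (C i)) (H j i) (dU i si) K0 (nK i si).
  rewrite [leRHS](_ : _ = 2 / card U i * (card U j / 2 * (\sum_(y in U i) (y \in C i)%:R + card U i / K)
     + edge_count R (w j i) (U j) (U i))).
    by rewrite ler_wpM2l ?divr_ge0 ?(ltW Ui0) // lerD2r.
  by rewrite /marked_density /edge_density; field; rewrite !gt_eqF.
have h2 : \sum_(x in U j) \sum_(i <- s) \sum_(l <- s) 4 / (card U i * card U l) *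
    (\sum_(y in U i) \sum_(z in U l) (w i l y z)%:R * (G x y == H j i)%:R * (G x z == H j l)%:R)
   <= card U j * (\sum_(i <- s) \sum_(l <- s) edge_density (w i l) (U i) (U l) +
         3 * (size s)%:R ^+ 2 / K).
  have -> : 3 * (size s)%:R ^+ 2 / K = \sum_(i <- s) \sum_(l <- s) (3 / K).
    by rewrite !sum_seq_const; ring.
  rewrite exchange_big /= -big_split mulr_sumr /=; apply: ler_sum_in => i si.
  rewrite exchange_big /= -big_split mulr_sumr /=; apply: ler_sum_in => l sl.
  have Ui0 := U0 i (inS i si); have Ul0 := U0 l (inS l sl).
  have h := sum_common_neighbours_le G_bd (w i l) (H j i) (H j l) (dU i si) (dU l sl) K0
    (nK i si) (nK l sl).
  rewrite -mulr_sumr [leRHS](_ : _ = 4 / (card U i * card U l) * (card U j / 4 *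
      (edge_count R (w i l) (U i) (U l) + 3 * (card U i * card U l / K)))).
    by rewrite ler_wpM2l ?divr_ge0 ?mulr_ge0 ?(ltW Ui0) ?(ltW Ul0).
  by rewrite /edge_density; field; rewrite !gt_eqF.
apply: le_trans (lerD (lerD (lexx _) h1) h2) _.
rewrite -!mulrDr ler_pM2l // /potential !big_cons.
rewrite [\sum_(i <- s) \sum_(l <- j :: s) _](_ : _ = \sum_(i <- s) edge_density (w j i) (U j) (U i)
   + \sum_(i <- s) \sum_(l <- s) edge_density (w i l) (U i) (U l)); last first.
  rewrite -big_split; apply: eq_bigr => i _; rewrite big_cons edge_densityC //.
have := edge_density_ge0 (w j j) (U j) (U j); lra.
Qed.

(** For a typical [x] each candidate set keeps at least a proportion [g / 2], so the
    true denominators differ from the nominal ones by a factor [g] for each set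
    involved. *)
Lemma potential_shrink j s U C x (g : R) : 0 < g -> g <= 1 ->
  {in s, forall i, 0 < card U i} ->
  {in s, forall i, g / 2 * card U i <= #|shrink j x U i|%:R} ->
  g ^+ 2 * potential s (shrink j x U) (mark j x C) + (x \in C j)%:R <= nominal j s U C x.
Proof.
move=> g0 g1 U0 big.
have sub i (f : V -> R) : \sum_(y in shrink j x U i) f y = \sum_(y in U i) f y * (G x y == H j i)%:R.
  rewrite [LHS]big_mkcond [RHS]big_mkcond; apply: eq_bigr => y _; rewrite inE.
  by case: (y \in U i) => //=; case: (_ == _); rewrite ?mulr1 ?mulr0.
have S0 i : i \in s -> 0 < #|shrink j x U i|%:R :> R.
  by move=> si; apply: lt_le_trans (big i si); rewrite mulr_gt0 ?divr_gt0 ?U0.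
have inv i : i \in s -> g / #|shrink j x U i|%:R <= 2 / card U i.
  move=> si; rewrite ler_pdivrMr ?S0 // mulrAC ler_pdivlMr ?U0 //.
  by have := big i si; lra.
rewrite addrC /nominal -[leRHS]addrA lerD2l /potential mulrDr; apply: lerD.
  rewrite mulr_sumr; apply: ler_sum_in => i si.
  rewrite /marked_density mulrCA mulrC sub.
  set L := (X in _ * X <= _); set L' := (X in _ <= _ * X).
  have LL : L <= L'.
    rewrite /L /L' -big_split; apply: ler_sum => y _; rewrite /mark !inE /=.
    case: (_ == _); rewrite ?mulr0 ?mulr1 ?add0r ?ler0n //.
    by case: (y \in C i); case: (w j i x y); rewrite /= ?addr0 ?add0r ?lerDl.
  have L0 : 0 <= L by apply: sumr_ge0 => y _; rewrite mulr_ge0.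
  apply: ler_pM => //; first by rewrite divr_ge0 ?exprn_ge0 ?(ltW g0).
  apply: le_trans (inv i si); rewrite ler_pM2r ?invr_gt0 ?S0 //.
  by rewrite expr2 ler_piMl // ltW.
rewrite mulr_sumr; apply: ler_sum_in => i si; rewrite mulr_sumr; apply: ler_sum_in => l sl.
rewrite /edge_density /edge_count mulrCA mulrC sub.
set L := (X in _ * X <= _); set L' := (X in _ <= _ * X).
have -> : L = L'.
  apply: eq_bigr => y _; rewrite sub mulr_suml; apply: eq_bigr => z _.
  by rewrite mulrAC.
apply: ler_wpM2r; first by do 2!apply: sumr_ge0 => ? _; rewrite !mulr_ge0.
rewrite [leRHS](_ : _ = (2 / card U i) * (2 / card U l)).
  rewrite expr2 invfM mulrACA; apply: ler_pM; rewrite ?inv // divr_ge0 ?(ltW g0) //.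
by have := U0 i si; have := U0 l sl => ? ?; field; rewrite !gt_eqF.
Qed.
End Potential.

Section PotentialEmbedding.
Variables (R : realFieldType) (V T : finType) (G : sgraph V) (H : rel T).
Variable w : T -> T -> rel V.
Hypothesis G_bd : seidel_bounded R G.
Hypothesis H_sym : symmetric H.
Hypothesis w_sym : forall i j x y, w i j x y = w j i y x.
Implicit Types (U C : T -> {set V}) (s : seq T).
Local Notation n := (#|V|%:R : R).
Local Notation card U i := (#|pred_of_set (U i)|%:R : R).

(** Choose for [j] a candidate that shrinks no other candidate set by much more than
    a half and for which the potential is at most average.  The potential then
    grows at each step at most by a factor [(1 - (2 * k)^-1)^-1] and an additive
    error [1 / (8 * k)], so it stays below 1 to the end; a forbidden image would
    cost 1.  Running this with densities, and not with individual forbidden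
    pairs, is what allows a density of forbidden pairs that is only polynomially
    small in [k] although the candidate sets shrink exponentially. *)
Lemma potential_embedding (v0 : V) (k : nat) (M : R) s U C :
  (0 < k)%N -> 0 < M -> n * (32 * k%:R ^+ 3) ^+ 2 <= M ^+ 2 ->
  uniq s -> (size s <= k)%N ->
  {in s &, forall i l, i != l -> [disjoint U i & U l]} ->
  {in s, forall i, 4 ^+ size s * M <= card U i} ->
  potential R w s U C + (size s)%:R / (8 * k%:R) <= (1 - (2 * k%:R)^-1) ^+ size s / 2 ->
  exists f : T -> V, {in s, forall i, f i \in U i :\: C i} /\
    {in s &, forall i l, i != l -> (G (f i) (f l) == H i l) && ~~ w i l (f i) (f l)}.
Proof.
move=> k0 M0 nM; have kap1 : 1 <= k%:R :> R by rewrite ler1n.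
have kap0 : 0 < k%:R :> R by rewrite ltr0n.
set kap := k%:R in kap1 kap0 nM *.
(* [a] is both the relative loss allowed when a candidate set is halved and the
   proportion of candidates that may be bad.  Two of the former and one of the
   latter enter each step, and [3 * a = (2 * k)^-1]. *)
pose a : R := (6 * kap)^-1.
have a0 : 0 < a by rewrite invr_gt0 mulr_gt0.
have a1 : a <= 1 / 6 by rewrite /a mul1r lef_pV2 ?posrE ?mulr_gt0 // ler_peMr.
pose g := 1 - a.
have g0 : 0 < g by rewrite /g; lra.
have g1 : g <= 1 by rewrite /g; lra.
set gam := 1 - (2 * kap)^-1.
have gamE : gam = 1 - 3 * a by rewrite /gam /a; field; rewrite gt_eqF.
have gam0 : 0 < gam by rewrite gamE; lra.
have gam1 : gam <= 1 by rewrite gamE; lra.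
have g3 : gam <= g ^+ 3 by rewrite gamE /g; nra.
pose e := (8 * kap)^-1.
have e0 : 0 < e by rewrite invr_gt0 mulr_gt0.
elim: s U C => [|j s IH] U C /=; first by exists (fun=> v0).
move=> /andP[js us] sk dU Ubig Phi_le.
have inS i : i \in s -> i \in j :: s by rewrite inE orbC => ->.
have neS i : i \in s -> j != i by move=> si; apply: contraNneq js => ->.
have Ule i : i \in j :: s -> M <= card U i.
  by move=> /Ubig; apply: le_trans; rewrite ler_peMl ?(ltW M0) // exprn_ege1 // ler1n.
have U0 : {in j :: s, forall i, 0 < card U i} by move=> i /Ule; apply: lt_le_trans.
have sle : (size s)%:R <= kap :> R by rewrite ler_nat ltnW.
have UU : {in s, forall i, n * (32 * kap ^+ 3) ^+ 2 <= card U j * card U i}.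
  move=> i si; apply: le_trans nM _; rewrite expr2.
  exact: ler_pM (ltW M0) (ltW M0) (Ule _ (mem_head _ _)) (Ule _ (inS _ si)).
have dUj : {in s, forall i, [disjoint U j & U i]}.
  by move=> i si; apply: dU (mem_head _ _) (inS i si) (neS i si).
have Uj0 := U0 j (mem_head _ _).
pose bad i x := #|shrink G H j x U i|%:R < g / 2 * card U i.
have few : {in s, forall i, #|[set x in U j | bad i x]|%:R <= card U j * (6 * kap ^+ 2)^-1}.
  move=> i si; have Ui0 := U0 i (inS i si).
  have := card_low_degree G_bd (H j i) (dUj i si) a0.
  rewrite -/g -/(bad i); set c := #|_|%:R => hc.
  rewrite ler_pdivlMr ?mulr_gt0 ?exprn_gt0 // -(ler_pM2r Ui0).
  apply: le_trans (UU i si).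
  have -> : c * (6 * kap ^+ 2) * card U i = c * card U i * a ^+ 2 * (216 * kap ^+ 4).
    by rewrite /a; field; rewrite gt_eqF.
  apply: le_trans (ler_wpM2r _ hc) _; first by rewrite mulr_ge0 ?exprn_ge0 ?(ltW kap0).
  rewrite ler_wpM2l //.
  have : 1 <= kap ^+ 2 by rewrite exprn_ege1.
  have : 0 <= kap ^+ 4 by rewrite exprn_ge0 // ltW.
  rewrite (_ : (32 * kap ^+ 3) ^+ 2 = 1024 * (kap ^+ 4 * kap ^+ 2)); last by ring.
  nra.
pose X := [set x in U j | ~~ has (bad^~ x) s].
have Xbig : g * card U j <= #|X|%:R.
  apply: le_trans (card_avoid few).
  have -> : (size s)%:R * (card U j * (6 * kap ^+ 2)^-1) = card U j * (a * ((size s)%:R / kap)).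
    by rewrite /a; field; rewrite gt_eqF.
  have : (size s)%:R / kap <= 1 by rewrite ler_pdivrMr // mul1r.
  move=> h; have : a * ((size s)%:R / kap) <= a by rewrite ler_piMr // ltW.
  rewrite /g; move: (a * _) => b hb; nra.
have X0 : (0 < #|X|)%N.
  by rewrite -(ltr0n R); apply: lt_le_trans Xbig; rewrite mulr_gt0.
have Phi0 : 0 <= potential R w (j :: s) U C.
  rewrite addr_ge0 //; apply: sumr_ge0 => i _; first exact: marked_density_ge0.
  by apply: sumr_ge0 => l _; exact: edge_density_ge0.
set Phi := potential R w (j :: s) U C in Phi_le Phi0.
have he : (size s)%:R / (32 * kap ^+ 3) + 3 * (size s)%:R ^+ 2 / (32 * kap ^+ 3) <= e.
  rewrite -mulrDl ler_pdivrMr ?mulr_gt0 ?exprn_gt0 //.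
  have -> : e * (32 * kap ^+ 3) = 4 * kap ^+ 2 by rewrite /e; field; rewrite gt_eqF.
  have : 0 <= (size s)%:R :> R by [].
  move: sle; move: (size s)%:R => z hz z0; nra.
have K0 : 0 < 32 * kap ^+ 3 by rewrite mulr_gt0 ?exprn_gt0.
have avg := nominal_average H G_bd w_sym C dUj K0 U0 UU he.
rewrite -/Phi in avg.
have nom_ge0 x : x \in U j -> 0 <= nominal R G H w j s U C x.
  move=> xU; rewrite !addr_ge0 //.
    apply: sumr_ge0 => i _; rewrite mulr_ge0 ?divr_ge0 // addr_ge0 //; apply: sumr_ge0 => y _ //.
    by rewrite mulr_ge0.
  do 2!apply: sumr_ge0 => ? _; rewrite mulr_ge0 ?divr_ge0 ?mulr_ge0 //.
  by do 2!apply: sumr_ge0 => ? _; rewrite !mulr_ge0.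
have [x xX nomx] : exists2 x, x \in X & nominal R G H w j s U C x <= (Phi + e) / g.
  apply: exists_le_average => //.
  apply: (@le_trans _ _ (card U j * (Phi + e))).
    apply: le_trans avg.
    rewrite [leRHS](bigID (mem X)) /= -[leLHS]addr0; apply: lerD.
      rewrite le_eqVlt; apply/orP; left; apply/eqP; apply: eq_bigl => x.
      by rewrite inE andbA andbb.
    by apply: sumr_ge0 => x /andP[xU _]; exact: nom_ge0.
  rewrite mulrA ler_pdivlMr // mulrAC [X in X * _ <= _]mulrC.
  by rewrite ler_wpM2r // addr_ge0 // ltW.
move: xX; rewrite inE => /andP[xUj /hasPn good].
have big : {in s, forall i, g / 2 * card U i <= #|shrink G H j x U i|%:R}.
  by move=> i si; have := good i si; rewrite -leNgt.
have := potential_shrink w C g0 g1 (fun i si => U0 i (inS i si)) big.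
set Phi' := potential R w s _ _ => /le_trans /(_ nomx).
rewrite ler_pdivlMr // => hPhi.
have Phi'0 : 0 <= Phi'.
  rewrite addr_ge0 //; apply: sumr_ge0 => i _; first exact: marked_density_ge0.
  by apply: sumr_ge0 => l _; exact: edge_density_ge0.
set t := size s in sk Ubig Phi_le sle he *.
have Phi_le' : Phi + e + t%:R * e <= gam * gam ^+ t / 2.
  by move: Phi_le; rewrite -exprS -natr1 mulrDl mul1r -/e; lra.
have gt1 : gam ^+ t <= 1 by rewrite exprn_ile1 // ltW.
have gt0 : 0 <= gam ^+ t by rewrite exprn_ge0 // ltW.
have te0 : 0 <= t%:R * e by rewrite mulr_ge0 // ltW.
have xC : x \notin C j.
  apply/negP => xC; move: hPhi; rewrite xC /= => hPhi.
  have : gam * gam ^+ t <= 1 by rewrite mulr_ile1 // ltW.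
  have := mulr_ge0 (mulr_ge0 (exprn_ge0 2 (ltW g0)) Phi'0) (ltW g0).
  rewrite mulrDl mul1r in hPhi; rewrite /g in hPhi *; lra.
have Phi'_le : Phi' + t%:R / (8 * kap) <= gam ^+ t / 2.
  rewrite -(ler_pM2l gam0) -/e mulrDr [leRHS]mulrA; apply: le_trans Phi_le'; apply: lerD.
    apply: le_trans hPhi; rewrite [leRHS]mulrDl.
    apply: (@le_trans _ _ (g ^+ 3 * Phi')); first by apply: (ler_wpM2r Phi'0 g3).
    rewrite (_ : g ^+ 3 * Phi' = g ^+ 2 * Phi' * g); last by ring.
    by rewrite lerDl mulr_ge0 // ltW.
  by rewrite ler_piMl.
have [||f [fU fG]] := IH (shrink G H j x U) (mark w j x C) us (ltnW sk) _ _ Phi'_le.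
- move=> i l si sl il.
  have dil := dU i l (inS i si) (inS l sl) il.
  apply: disjointWl (disjointWr _ dil); apply/subsetP => y; rewrite inE => /andP[] //.
- move=> i si; apply: le_trans (big i si); have := Ubig i (inS i si).
  have := U0 i (inS i si); rewrite exprS -mulrA /g; move: (_ * M) (card U i) => p q; nra.
have xP l : l \in s -> (G x (f l) == H j l) && ~~ w j l x (f l).
  by move=> sl; have := fU l sl; rewrite !inE negb_or => /andP[/andP[_ ->] /andP[_ ->]].
exists (fun i => if i == j then x else f i); split=> [i|i l].
  rewrite in_cons; case: eqP => [-> _|_ /= si]; first by rewrite inE xC.
  by have := fU i si; rewrite !inE negb_or => /andP[/andP[-> _] /andP[-> _]].
rewrite !in_cons; case: (i =P j) => [-> _|_ /= si]; case: (l =P j) => [-> _|_ /= sl] il.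
- by rewrite eqxx in il.
- exact: xP.
- by rewrite adj_sym H_sym w_sym xP.
- exact: fG.
Qed.
End PotentialEmbedding.

(** * Monochromatic copies and embeddings *)

(** [insub] turns the pair into an edge when it is one, so that no proof of
    adjacency has to be carried along; a pair that is not an edge has no
    colour. *)
Definition colored (V : finType) (G : sgraph V) q (chi : edge_coloring G q) (a : 'I_q) : rel V :=
  fun x y => omap chi (insub [set x; y]) == Some a.

Lemma colored_sym (V : finType) (G : sgraph V) q (chi : edge_coloring G q) a :
  symmetric (colored chi a).
Proof. by move=> x y; rewrite /colored setUC. Qed.

Lemma edge_mem (V : finType) (G : sgraph V) x y : G x y -> [set x; y] \in edges G.
Proof. by move=> Gxy; rewrite inE; apply/existsP; exists x; apply/existsP; exists y; rewrite Gxy eqxx. Qed.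

Lemma edge_colored (V : finType) (G : sgraph V) q (chi : edge_coloring G q) x y :
  G x y -> exists a, colored chi a x y.
Proof. by move=> /edge_mem e; rewrite /colored insubT /=; eexists; apply: eqxx. Qed.

Lemma induced_mono_copy_of_embedding (V W : finType) (G : sgraph V) (H : sgraph W) q
    (chi : edge_coloring G q) (a : 'I_q) (f : W -> V) :
  injective f -> (forall i l, i != l -> G (f i) (f l) = H i l) ->
  (forall i l, H i l -> colored chi a (f i) (f l)) -> has_induced_mono_copy H chi.
Proof.
move=> f_inj fG fcol; pose S := [set f i | i : W].
have GH i l : G (f i) (f l) = H i l.
  by have [->|/fG //] := eqVneq i l; rewrite !adj_irr.
have fS i : f i \in S by apply: imset_f.
exists S; split; last first.
  exists a => -[e eE] /= eS; have := eE; rewrite inE => /existsP[x /existsP[y /andP[Gxy /eqP ee]]].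
  have [xS yS] : x \in S /\ y \in S by split; apply: (subsetP eS); rewrite ee !inE eqxx ?orbT.
  have /imsetP[i _ xi] := xS; have /imsetP[l _ yl] := yS.
  have := fcol i l; rewrite -GH -xi -yl Gxy => /(_ isT).
  rewrite /colored -ee insubT /= => /eqP[<-]; congr chi; exact: val_inj.
pose g i : {x | x \in S} := Sub (f i) (fS i).
have g_inj : injective g by move=> i l /(congr1 val) /f_inj.
have g_surj x : exists i, g i == x.
  have /imsetP[i _ xi] := valP x; exists i; apply/eqP/val_inj; exact: esym.
pose h x := xchoose (g_surj x).
have hK : cancel h g by move=> x; apply/eqP/(xchooseP (g_surj x)).
have gK : cancel g h by move=> i; apply: g_inj; rewrite hK.
exists h; first by exists g.
by move=> x y; rewrite -{2}[x]hK -{2}[y]hK /= /induced_adj /= GH.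
Qed.

Lemma equipartition (V T : finType) (v0 : V) (U : {set V}) (q : nat) : (#|T| * q <= #|U|)%N ->
  exists W : T -> {set V}, [/\ forall i, W i \subset U,
    forall i l, i != l -> [disjoint W i & W l] & forall i, #|W i| = q].
Proof.
move=> TqU; pose pos (i : T) (a : 'I_q) := (enum_rank i * q + a)%N.
have posU i a : (pos i a < size (enum U))%N.
  rewrite -cardE; apply: leq_trans TqU; apply: (@leq_trans ((enum_rank i).+1 * q)).
    by rewrite /pos mulSn addnC ltn_add2r.
  by rewrite leq_mul2r (ltn_ord (enum_rank i)) orbT.
have posI i l a b : nth v0 (enum U) (pos i a) = nth v0 (enum U) (pos l b) -> i = l /\ a = b.
  move=> /eqP; rewrite nth_uniq ?enum_uniq // => /eqP E.
  have q0 : (0 < q)%N by apply: leq_ltn_trans (ltn_ord a).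
  split; last first.
    apply/val_inj; have := congr1 (modn^~ q) E.
    by rewrite /pos !modnMDl !modn_small.
  apply/enum_rank_inj/val_inj; have := congr1 (divn^~ q) E.
  by rewrite /pos !divnMDl // !divn_small // !addn0.
exists (fun i => [set nth v0 (enum U) (pos i a) | a : 'I_q]); split=> [i|i l il|i].
- by apply/subsetP => _ /imsetP[a _ ->]; rewrite -mem_enum mem_nth.
- apply/pred0P => x /=; apply/negP => /andP[/imsetP[a _ ->] /imsetP[b _ /posI[E _]]].
  by rewrite E eqxx in il.
- by rewrite card_imset ?card_ord // => a b /posI[].
Qed.

(** * The dense and the sparse case *)

Section TwoCases.
Variables (R : realFieldType) (V T : finType) (G : sgraph V) (H : sgraph T).
Variable red : rel V.
Hypothesis G_bd : seidel_bounded R G.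
Hypothesis red_sym : symmetric red.
Local Notation n := (#|V|%:R : R).

(** If the red graph is dense between all large disjoint subsets of [U], then [H]
    embeds greedily with its edges on red edges and its non-edges on non-edges:
    non-adjacency is dense between large sets in any pseudo-random graph. *)
Lemma dense_embedding (v0 : V) (U : {set V}) (r m : R) :
  0 < r -> r <= 1 / 6 -> 0 < m -> 4 * n <= m ^+ 2 ->
  (forall A B : {set V}, A \subset U -> B \subset U -> [disjoint A & B] ->
     m <= #|A|%:R -> m <= #|B|%:R -> r * #|A|%:R * #|B|%:R <= edge_count R red A B) ->
  (0 < #|T|)%N -> (#|T| <= #|U|)%N ->
  2 * #|T|%:R ^+ 2 * m <= r ^+ #|T| * #|U|%:R ->
  exists f : T -> V, injective f /\
    forall i l, i != l -> if H i l then red (f i) (f l) else ~~ G (f i) (f l).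
Proof.
move=> r0 r6 m0 nm dense T0 TU Ubig.
have r1 : r <= 1 by lra.
have T0' : 0 < #|T|%:R :> R by rewrite ltr0n.
pose q := (#|U| %/ #|T|)%N.
have [|W [WU dW cW]] := @equipartition V T v0 U q; first by rewrite mulnC /q leq_divM.
have q1 : (0 < q)%N by rewrite divn_gt0.
have Uq : #|U|%:R <= 2 * #|T|%:R * q%:R :> R.
  rewrite -!natrM ler_nat -mulnA mulnC.
  have := ltn_ceil #|U| T0; rewrite -/q mulSn; move: T0 q1; clear; nia.
pose Q i l x y := if H i l then red x y else ~~ G x y.
have Qsym i l x y : Q i l x y = Q l i y x by rewrite /Q [H l i]adj_sym [G y x]adj_sym red_sym.
have n0 : 0 < n by rewrite ltr0n; apply/card_gt0P; exists v0.
have Qdense i l (A B : {set V}) : i != l -> A \subset W i -> B \subset W l ->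
    m <= #|A|%:R -> m <= #|B|%:R ->
    exists2 x, x \in A & r * #|B|%:R <= #|[set y in B | Q i l x y]|%:R.
  move=> il AW BW mA mB.
  have dAB : [disjoint A & B] := disjointWl AW (disjointWr BW (dW i l il)).
  have A0 : (0 < #|A|)%N by rewrite -(ltr0n R) (lt_le_trans m0).
  rewrite /Q; case: (H i l).
    have := dense A B (subset_trans AW (WU i)) (subset_trans BW (WU l)) dAB mA mB.
    rewrite /edge_count => h.
    have [||x xA hx] := @exists_le_average R V A (fun x => - \sum_(y in B) (red x y)%:R) (- (r * #|B|%:R)).
    - by [].
    - by rewrite sumrN mulrN lerN2 mulrCA mulrA.
    - by exists x => //; rewrite -sum_indicator -lerN2.
  (* The proportion that counts as low is then (1 - 2/3) / 2 = 1/6 >= r. *)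
  have e0 : 0 < 2 / 3 :> R by lra.
  have := card_low_degree G_bd false dAB e0.
  set X := [set x in A | _] => hX.
  have [x xA xX] : exists2 x, x \in A & x \notin X.
    apply/subsetPn; apply/negP => /subset_leq_card; rewrite -(ler_nat R) => AX.
    have mm : m ^+ 2 <= #|A|%:R * #|B|%:R by rewrite expr2; apply: ler_pM => //; exact: ltW.
    have : #|A|%:R * #|B|%:R <= #|X|%:R * #|B|%:R :> R by apply: ler_wpM2r.
    by move: (#|X|%:R * _) (#|A|%:R * _) hX mm => a b; lra.
  exists x => //; move: xX; rewrite inE xA /= -leNgt.
  have -> : [set y in B | ~~ G x y] = [set y in B | G x y == false].
    by apply/setP => y; rewrite !inE eqbF_neg.
  by apply: le_trans; apply: ler_wpM2r => //; lra.
have [||||f [fW fQ]] := @greedy_embedding R V T Q W m r Qsym m0 r0 r1 Qdense v0 #|T| (enum T) W.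
- exact: enum_uniq.
- by rewrite -cardE.
- by move=> i _.
- move=> i _; rewrite -cardE cW -(ler_pM2l T0') -(ler_pM2l (ltr0n R 2)).
  apply: (@le_trans _ _ (r ^+ #|T| * #|U|%:R)).
    by apply: le_trans Ubig; rewrite le_eqVlt; apply/orP; left; apply/eqP; ring.
  apply: le_trans (ler_wpM2l _ Uq) _; first by rewrite exprn_ge0 // ltW.
  by rewrite le_eqVlt; apply/orP; left; apply/eqP; ring.
exists f; split; last by move=> i l il; apply: fQ; rewrite ?mem_enum.
move=> i l fil; apply/eqP/negPn/negP => il.
by have := disjoint_neq (dW i l il) (fW i (mem_enum _ _)) (fW l (mem_enum _ _)); rewrite fil eqxx.
Qed.

Lemma bernoulli_sub (x : R) t : 0 <= x -> x <= 1 -> 1 - t%:R * x <= (1 - x) ^+ t.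
Proof.
move=> x0 x1; elim: t => [|t IH]; first by rewrite mul0r subr0.
rewrite exprS; apply: (@le_trans _ _ ((1 - x) * (1 - t%:R * x))); last first.
  by rewrite ler_wpM2l // subr_ge0.
have := mulr_ge0 (mulr_ge0 (ler0n R t) x0) x0; rewrite -natr1; lra.
Qed.

(** If the red density is small between any two of [#|T|] disjoint large sets, then
    one vertex can be taken from each set so that an induced copy of [H] without
    red edges results. *)
Lemma sparse_embedding (v0 : V) (W : T -> {set V}) (r M : R) :
  (0 < #|T|)%N -> 0 < M -> n * (32 * #|T|%:R ^+ 3) ^+ 2 <= M ^+ 2 ->
  0 <= r -> 8 * #|T|%:R ^+ 2 * r <= 1 ->
  (forall i, 4 ^+ #|T| * M <= #|W i|%:R) ->
  (forall i l, i != l -> [disjoint W i & W l]) ->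
  (forall i l, i != l -> edge_count R red (W i) (W l) <= r * #|W i|%:R * #|W l|%:R) ->
  exists f : T -> V, injective f /\
    (forall i l, i != l -> G (f i) (f l) = H i l) /\
    (forall i l, H i l -> ~~ red (f i) (f l)).
Proof.
move=> T0 M0 nM r0 Tr Wbig dW eW.
have T0' : 0 < #|T|%:R :> R by rewrite ltr0n.
have T1 : 1 <= #|T|%:R :> R by rewrite ler1n.
pose w i l x y := H i l && red x y.
have w_sym i l x y : w i l x y = w l i y x by rewrite /w adj_sym red_sym.
have pot : potential R w (enum T) W (fun=> set0) <= #|T|%:R ^+ 2 * r.
  rewrite /potential big1 ?add0r => [|i _]; last first.
    by rewrite /marked_density big1 ?mul0r // => y _; rewrite inE.
  have -> : #|T|%:R ^+ 2 * r = \sum_(i <- enum T) \sum_(l <- enum T) r.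
    by rewrite !sum_seq_const -cardE; ring.
  apply: ler_sum => i _; apply: ler_sum => l _.
  have [<-|il] := eqVneq i l.
    by rewrite /edge_density /edge_count big1 ?mul0r // => x _; rewrite big1 // => y _; rewrite /w adj_irr.
  have W0 j : 0 < #|W j|%:R :> R by apply: lt_le_trans (Wbig j); rewrite mulr_gt0 ?exprn_gt0.
  rewrite ler_pdivrMr ?mulr_gt0 // mulrA; apply: le_trans (eW i l il).
  apply: ler_sum => x _; apply: ler_sum => y _; rewrite /w.
  by case: (H i l) => //=; rewrite ler0n.
have [|||||f [fW fG]] := @potential_embedding R V T G H w G_bd (adj_sym H) w_sym v0 #|T| M
    (enum T) W (fun=> set0) T0 M0 nM.
- exact: enum_uniq.
- by rewrite -cardE.
- by move=> i l _ _; apply: dW.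
- by move=> i _; rewrite -cardE.
- rewrite -cardE; have half : #|T|%:R / (8 * #|T|%:R) = 1 / 8 :> R by field; rewrite gt_eqF.
  have := @bernoulli_sub (2 * #|T|%:R)^-1 #|T|.
  rewrite (_ : #|T|%:R * _ = 1 / 2 :> R); last by field; rewrite gt_eqF.
  rewrite half invr_ge0 mulr_ge0 // => /(_ isT) h.
  have {}h : 1 - 1 / 2 <= (1 - (2 * #|T|%:R)^-1) ^+ #|T| :> R.
    by apply: h; rewrite invf_le1 ?mulr_gt0  // -natrM ler1n muln_gt0.
  move: Tr; rewrite -mulrA; move: (potential _ _ _ _ _) (_ * r) pot => p s ps s1.
  by move: (_ ^+ #|T|) h => z; lra.
have fG' i l : i != l -> (G (f i) (f l) == H i l) && ~~ w i l (f i) (f l).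
  by apply: fG; rewrite mem_enum.
have fW' i : f i \in W i by have := fW i; rewrite mem_enum => /(_ isT); rewrite inE => /andP[].
exists f; split; [|split].
- move=> i l fil; apply/eqP/negPn/negP => il.
  by have := disjoint_neq (dW i l il) (fW' i) (fW' l); rewrite fil eqxx.
- by move=> i l /fG' /andP[/eqP].
- move=> i l Hil; have il : i != l by apply: contraTneq Hil => ->; rewrite adj_irr.
  by have /andP[_] := fG' i l il; rewrite /w Hil.
Qed.
End TwoCases.

Lemma up_log2_le (k : nat) : (1 < k)%N -> (2 ^ up_log 2 k <= 2 * k)%N.
Proof.
move=> k1; have /andP[lb _] := up_log_bounds (isT : (1 < 2)%N) k1.
by rewrite -[up_log 2 k]prednK ?up_log_gt0 // expnS leq_mul2l /= ltnW.
Qed.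

(** The red density threshold is [r = k ^- 9], and a subset of a set [U] is large if
    it has at least [d * #|U|] elements, where [d / 2 = D^-1].  Either some [U] of
    size at least [n / D ^ t] has no sparse pair of large subsets, and red can be
    used, or [2 ^ t >= k] sets of that size with pairwise small red density exist,
    and the other colour can be used. *)
Theorem two_coloring_mono_copy (R : realFieldType) (V T : finType) (G : sgraph V) (H : sgraph T)
    (chi : edge_coloring G 2) :
  seidel_bounded R G -> (1 < #|T|)%N ->
  ((2 * #|T| ^ (9 * #|T| + 3)) ^ (2 * (up_log 2 #|T|).+1) <= #|V|)%N ->
  has_induced_mono_copy H chi.
Proof.
move=> G_bd; set k := #|T| => k1; set t := up_log 2 k => nbig.
have k0 : (0 < k)%N := ltnW k1.
have [v0 _] : exists v0 : V, v0 \in V.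
  by apply/card_gt0P; apply: leq_trans nbig; rewrite !(expn_gt0, muln_gt0) k0.
set n : R := #|V|%:R.
pose kap : R := k%:R.
have kap2 : 2 <= kap by rewrite /kap ler_nat.
have kap0 : 0 < kap by lra.
have kap1 : 1 <= kap by lra.
have pow0 i : 0 < kap ^+ i by rewrite exprn_gt0.
pose D : R := 2 * kap ^+ (9 * k + 3).
have D0 : 0 < D by rewrite mulr_gt0.
have D1 : 1 <= D by have := exprn_ege1 (9 * k + 3) kap1; rewrite /D; lra.
have Dt0 i : 0 < D ^+ i by rewrite exprn_gt0.
have nD : D ^+ t.+1 * D ^+ t.+1 <= n.
  by rewrite -exprD addnn -mul2n /D /kap -natrX -natrM -natrX ler_nat.
have n0 : 0 < n by apply: lt_le_trans nD; rewrite mulr_gt0.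
(* Between the sizes n / D^t of the sparse family and the square root of n there
   is a factor D; it must absorb the shrinking 4^k and the error term of the
   potential argument. *)
have Dbig : 4 ^+ k * (32 * kap ^+ 3) <= D.
  have h4 : 4 ^+ k <= kap ^+ (2 * k) by rewrite exprM lerXn2r ?nnegrE ?exprn_ge0 ?(ltW kap0) //; nra.
  have h16 : 16 <= kap ^+ (7 * k).
    apply: (@le_trans _ _ (kap ^+ 4)); last by rewrite ler_weXn2l //; lia.
    have : 2 ^+ 4 <= kap ^+ 4 by rewrite lerXn2r ?nnegrE // ltW.
    by rewrite -natrX.
  rewrite /D (_ : 9 * k + 3 = 2 * k + (7 * k + 3))%N; last by lia.
  rewrite (exprD _ (2 * k)%N) (exprD _ (7 * k)%N); have x0 : 0 <= 4 ^+ k :> R by rewrite exprn_ge0.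
  have := pow0 3%N; move: (kap ^+ 3) => c c0.
  move: (4 ^+ k) (kap ^+ (2 * k)) (kap ^+ (7 * k)) h4 h16 x0 => x y z xy z16 x0.
  have h : 0 <= y * (z - 16) by rewrite mulr_ge0 //; lra.
  by rewrite !mulrA ler_pM2r //; lra.
pose r : R := (kap ^+ 9)^-1.
have r0 : 0 < r by rewrite invr_gt0.
have k6 : 64 <= kap ^+ 6.
  have : 2 ^+ 6 <= kap ^+ 6 by rewrite lerXn2r ?nnegrE // ltW.
  by rewrite -natrX.
have r64 : 64 * kap ^+ 3 * r <= 1.
  by rewrite /r ler_pdivrMr // mul1r (exprD _ 6 3) ler_pM2r.
have r6 : r <= 1 / 6.
  have : 1 <= kap ^+ 3 by rewrite exprn_ege1.
  nra.
pose d : R := 2 / D.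
have d0 : 0 < d by rewrite divr_gt0.
have d2 : d / 2 = D^-1 by rewrite /d; field; rewrite gt_eqF.
have d1 : d <= 1.
  have := exprn_ege1 (9 * k + 3) kap1; rewrite /d ler_pdivrMr // mul1r /D; lra.
pose u0 : R := (d / 2) ^+ t * n.
have u0E : u0 * D ^+ t = n by rewrite /u0 d2 exprVn mulrAC mulVf ?mul1r // gt_eqF.
have u0_0 : 0 < u0 by rewrite -(pmulr_lgt0 _ (Dt0 t)) u0E.
have u0_big : D ^+ t.+1 * D <= u0.
  rewrite -(ler_pM2r (Dt0 t)) u0E; apply: le_trans nD.
  by rewrite -mulrA -exprS.
pose red : rel V := fun x y => G x y && colored chi ord0 x y.
have red_sym : symmetric red by move=> x y; rewrite /red adj_sym colored_sym.
(* The dichotomy is decided by a boolean because all sets involved are finite. *)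
case: (boolP [exists U : {set V}, (u0 <= #|U|%:R) && [forall A : {set V}, forall B : {set V},
   [&& A \subset U, B \subset U, [disjoint A & B],
     d * #|U|%:R <= #|A|%:R & d * #|U|%:R <= #|B|%:R] ==>
   (r * #|A|%:R * #|B|%:R < edge_count R red A B)]]).
  case/existsP => U /andP[Ubig /forallP dense].
  have U0 : 0 < #|U|%:R :> R by apply: lt_le_trans Ubig.
  have [||||||f [f_inj fQ]] := @dense_embedding R V T G H red G_bd red_sym v0 U r (d * #|U|%:R) r0 r6.
  - by rewrite mulr_gt0.
  - have du : 2 * n <= d * #|U|%:R * D ^+ t.+1.
      rewrite exprS -u0E /d (_ : 2 / D * _ * _ = 2 * (#|U|%:R * D ^+ t)).
        by rewrite ler_pM2l // (ler_pM2r (Dt0 t)); exact: Ubig.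
      by field; rewrite gt_eqF.
    have du0 : 0 <= d * #|U|%:R by rewrite mulr_ge0 // ltW.
    rewrite -(ler_pM2r n0); apply: (@le_trans _ _ ((d * #|U|%:R * D ^+ t.+1) ^+ 2)).
      rewrite (_ : 4 * n * n = (2 * n) ^+ 2); last by ring.
      have dD := mulr_ge0 du0 (ltW (Dt0 t.+1)).
      by rewrite lerXn2r ?nnegrE // mulr_ge0.
    by rewrite exprMn; apply: ler_wpM2l nD; rewrite exprn_ge0.
  - move=> A B AU BU dAB Am Bm; apply: ltW.
    by move/forallP: (dense A) => /(_ B); rewrite AU BU dAB Am Bm.
  - exact: k0.
  - rewrite -/k -(ler_nat R); apply: le_trans Ubig; apply: le_trans u0_big.
    apply: (@le_trans _ _ D); last by rewrite ler_peMl ?(ltW D0) // exprn_ege1.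
    rewrite -/kap /D addn3 exprS mulrA.
    have := exprn_ege1 (9 * k).+2 kap1; move: (_ ^+ _) => z; nra.
  - rewrite -/k -/kap mulrA ler_pM2r // /d /D /r exprVn -exprM (exprD _ (9 * k)%N).
    have := pow0 (9 * k)%N; set z := kap ^+ (9 * k) => z0.
    rewrite [leLHS](_ : _ = 2 / kap * z^-1); last by field; rewrite !gt_eqF.
    by rewrite ler_piMl ?invr_ge0 ?(ltW z0) // ler_pdivrMr // mul1r.
  apply: (@induced_mono_copy_of_embedding _ _ _ _ _ chi ord0 f) => // [i l /fQ|i l Hil].
    by case: (H i l) => [/andP[]|/negPf].
  have il : i != l by apply: contraTneq Hil => ->; rewrite adj_irr.
  by have := fQ i l il; rewrite Hil => /andP[].
move=> /existsPn nodense.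
have sp (U : {set V}) : u0 <= #|U|%:R ->
  exists A B : {set V}, [/\ A \subset U, B \subset U, [disjoint A & B],
    d * #|U|%:R <= #|A|%:R /\ d * #|U|%:R <= #|B|%:R &
    edge_count R red A B <= r * #|A|%:R * #|B|%:R].
  move=> uU; have := nodense U; rewrite uU /= => /forallPn[A /forallPn[B]].
  rewrite negb_imply -leNgt => /andP[/and5P[AU BU dAB Am Bm] e].
  by exists A, B.
have [||Ws [szW WsP pw]] := @sparse_family R V red d r u0 (2 ^ t) red_sym d0 d1 r0 u0_0 sp t setT.
- exact: leqnn.
- by rewrite cardsT.
have tk : (k <= 2 ^ t)%N by exact: (@up_logP 2 k isT).
pose W (i : T) := nth set0 Ws (enum_rank i).
have szi (i : T) : (enum_rank i < size Ws)%N by rewrite szW (leq_trans _ tk).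
have WW i : W i \in Ws by apply: mem_nth.
have Wpair i l : i != l -> sparse red r (2 ^ t) (W i) (W l).
  have sp_sym A B : sparse red r (2 ^ t) A B = sparse red r (2 ^ t) B A.
    rewrite /sparse disjoint_sym edge_countC //; congr (_ && (_ <= _)); ring.
  wlog il : i l / (enum_rank i < enum_rank l)%N.
    move=> hw il; have := il; rewrite -(inj_eq enum_rank_inj) -val_eqE /= neq_ltn.
    by case/orP => h; [apply: hw | rewrite sp_sym; apply: hw; rewrite // eq_sym].
  by move=> _; have /(pairwiseP set0) pw' := pw; apply: pw'; rewrite ?inE.
have [|||||||f [f_inj [fG fred]]] :=
  @sparse_embedding R V T G H red G_bd red_sym v0 W (4 * (2 ^ t)%:R * r) (u0 / 4 ^+ k) k0.
- by rewrite divr_gt0 // exprn_gt0.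
- rewrite -/k -/kap -/n expr_div_n ler_pdivlMr ?exprn_gt0 // -mulrA -exprMn.
  rewrite [_ * 4 ^+ k]mulrC.
  rewrite -(ler_pM2r (exprn_gt0 2 (Dt0 t))) -[leRHS]exprMn u0E [leRHS]expr2 -mulrA ler_pM2l //.
  rewrite -exprMn; apply: le_trans nD; rewrite -expr2 lerXn2r ?nnegrE ?mulr_ge0 ?exprn_ge0 ?(ltW D0) ?(ltW kap0) //.
  by rewrite [leRHS]exprS (ler_pM2r (Dt0 t)).
- by rewrite !mulr_ge0 // ltW.
- have := up_log2_le k1; rewrite -/t -(ler_nat R) natrM -/k -/kap => h.
  rewrite -/k -/kap; apply: le_trans r64.
  rewrite [leRHS](_ : _ = (8 * kap ^+ 2 * 4 * r) * (2 * kap)); last by ring.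
  rewrite [leLHS](_ : _ = (8 * kap ^+ 2 * 4 * r) * (2 ^ t)%:R); last by ring.
  by rewrite ler_pM2l // !mulr_gt0.
- move=> i; rewrite -/k [_ * (u0 / _)]mulrC divfK ?gt_eqF ?exprn_gt0 //.
  by have [_] := WsP _ (WW i); rewrite cardsT.
- by move=> i l /Wpair /andP[].
- by move=> i l /Wpair /andP[].
apply: (@induced_mono_copy_of_embedding _ _ _ _ _ chi ord_max f) => // i l Hil.
have il : i != l by apply: contraTneq Hil => ->; rewrite adj_irr.
have Gil : G (f i) (f l) by rewrite fG.
have [a] := edge_colored chi Gil.
have := fred i l Hil; rewrite /red Gil /=.
case: (unliftP ord_max a) => [b ->|-> //]; rewrite (_ : lift _ _ = ord0) => [/negP //|].
by apply: val_inj; rewrite (ord1 b).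
Qed.

(** * The threshold *)

Lemma powR_log2 (R : realType) (x : R) : 0 < x -> 2 `^ log2 x = x.
Proof.
move=> x0; rewrite /powR gt_eqF // /log2 divfK ?lnK ?posrE //.
by rewrite gt_eqF // ln_gt0 // ltr1n.
Qed.

Lemma log2_ge (R : realType) (m k : nat) : (2 ^ m <= k)%N -> m%:R <= log2 k%:R :> R.
Proof.
move=> mk; have l2 : 0 < ln 2 :> R by rewrite ln_gt0 // ltr1n.
have k0 : (0 < k)%N by apply: leq_trans mk; rewrite expn_gt0.
rewrite /log2 ler_pdivlMr // mulrC mulr_natr -lnXn // ler_ln ?posrE ?exprn_gt0 ?ltr0n //.
by rewrite -natrX ler_nat.
Qed.

(** The base is at most [k ^ (11 * k)] and [up_log 2 k + 1] is at most
    [3 * log2 k], which gives the constant [66 = 11 * 2 * 3]. *)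
Lemma threshold_bound (R : realType) (k n : nat) : (1 < k)%N ->
  2 `^ (66 * k%:R * log2 k%:R ^+ 2) <= n%:R :> R ->
  ((2 * k ^ (9 * k + 3)) ^ (2 * (up_log 2 k).+1) <= n)%N.
Proof.
move=> k1; set L : R := log2 k%:R => hn; set t := up_log 2 k.
have k0 : (0 < k)%N := ltnW k1.
have L1 : 1 <= L by apply: (@log2_ge R 1).
have tL : t.+1%:R <= 3 * L.
  have t0 : (0 < t)%N by rewrite up_log_gt0.
  have : t.-1%:R <= L by apply: log2_ge; have /andP[/ltnW] := up_log_bounds (isT : (1 < 2)%N) k1.
  have -> : t.+1%:R = t.-1%:R + 2 :> R by rewrite -natrD; congr _%:R; lia.
  lra.
rewrite -(ler_nat R); apply: le_trans hn.
apply: (@le_trans _ _ ((k ^ (22 * k * t.+1))%:R)).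
  rewrite ler_nat (_ : 22 * k * t.+1 = 11 * k * (2 * t.+1))%N; last by lia.
  rewrite [leqRHS]expnM leq_exp2r ?muln_gt0 //.
  apply: (@leq_trans (k * k ^ (9 * k + 3))); first by rewrite leq_mul2r k1 orbT.
  by rewrite -expnS leq_pexp2l //; lia.
rewrite natrX -[X in X ^+ _](@powR_log2 R) ?ltr0n // -/L -[leLHS]powR_mulrn ?powR_ge0 // -powRrM.
apply: ler_powR; first by rewrite ler1n.
rewrite !natrM [leLHS](_ : _ = 22 * k%:R * L * t.+1%:R); last by ring.
rewrite [leRHS](_ : _ = 22 * k%:R * L * (3 * L)); last by ring.
have L0 : 0 <= L := le_trans ler01 L1.
by apply: ler_wpM2l tL; apply: mulr_ge0 L0; rewrite mulr_ge0.
Qed.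

Theorem corollary1p6 (R : realType) :
  exists c : R,
    forall k : nat, (0 < k)%N ->
    forall (n : nat) (n_pr : prime n) (n_mod4 : (n = 1 %[mod 4])%N),
      2 `^ (c * k%:R * log2 k%:R ^+ 2) <= n%:R :> R ->
    forall (T : finType) (H : sgraph T), #|T| = k ->
    forall chi : edge_coloring (paley_Fp n_pr n_mod4) 2,
      has_induced_mono_copy H chi.
Proof.
exists 66 => k k0 n n_pr n_mod4 hn T H Tk chi.
(* For k = 1 the hypothesis holds for every n, and any vertex is a copy of H. *)
have [k1|k1] := leqP k 1.
  have T1 (i l : T) : i = l by apply: (fintype_le1P _); rewrite Tk.
  apply: (@induced_mono_copy_of_embedding _ _ _ _ _ chi ord0 (fun=> 0)) => [i l _ //|i l|i l].
  - by rewrite (T1 i l) eqxx.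
  - by rewrite (T1 i l) adj_irr.
apply: (two_coloring_mono_copy (R := R)); rewrite ?Tk //; first exact: paley_seidel_bounded.
by rewrite card_Fp //; apply: threshold_bound hn.
Qed.
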